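(* Let $2\leq s<\infty$ be an integer, let $\{3,5\}$ denote the icosahedron, and let $\rho_0,\rho_1,\rho_2,\rho_3$ be the distinguished generators of $G(2^{\{3,5\},\mathcal{G}(s)})$. Put $\tilde{\rho}_0:=\rho_0\rho_1\rho_0$ and $H:=H(2^{\{3,5\},\mathcal{G}(s)})=\langle\tilde{\rho}_0,\rho_1,\rho_2,\rho_3\rangle$. Then the incidence system $\mathcal{H}(2^{\{3,5\},\mathcal{G}(s)})=\Gamma(H;(H_i)_{i\in\{0,\dots,3\}})$ is a regular hypertope and its automorphism group $H$, of order $60\cdot(2s)^6$, is the quotient of the Coxeter group with generators $\tilde{\rho}_0,\rho_1,\rho_2,\rho_3$ and Coxeter relations $$\tilde{\rho}_0^2=\rho_1^2=\rho_2^2=\rho_3^2=(\tilde{\rho}_0\rho_2)^3=(\rho_1\rho_2)^3=(\rho_2\rho_3)^5=(\tilde{\rho}_0\rho_1)^2=(\tilde{\rho}_0\rho_3)^2=(\rho_1\rho_3)^2=id$$ by the relations $$(\tilde{\beta}^{-3}\beta^3)^2=id\quad\text{and}\quad(\tilde{\beta}^5\beta^5)^s=id,$$ where $\beta:=\rho_1\rho_2\rho_3$ and $\tilde{\beta}:=\tilde{\rho}_0\rho_2\rho_3$.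
   Context: C-groups and polytopes: a C-group of rank $m$ is a group $G$ with generating involutions $\rho_0,\dots,\rho_{m-1}$ satisfying $\langle\rho_i\mid i\in I\rangle\cap\langle\rho_j\mid j\in J\rangle=\langle\rho_k\mid k\in I\cap J\rangle$ for all $I,J\subseteq\{0,\dots,m-1\}$; it is a string C-group if $(\rho_i\rho_j)^2=id$ whenever $|i-j|\geq 2$. Abstract regular polytopes $\mathcal{P}$ of rank $m$ are in one-to-one correspondence with string C-groups $G(\mathcal{P})$ of rank $m$: the $i$-faces are the right cosets of $\langle\rho_j\mid j\neq i\rangle$, and vertices are the $0$-faces. Construction of $2^{\mathcal{P},\mathcal{G}(s)}$: let $\mathcal{P}$ be a centrally symmetric regular $n$-polytope with group $G(\mathcal{P})=\langle\tau_0,\dots,\tau_{n-1}\rangle$, i.e. $G(\mathcal{P})$ has a proper central involution $\alpha$ fixing no vertex. Let $F_0$ be the base vertex, stabilized by $\langle\tau_1,\dots,\tau_{n-1}\rangle$. Let $W$ be the Coxeter group generated by involutions $\sigma_F$, one for each vertex $F$ of $\mathcal{P}$, with defining relations $\sigma_F^2=id$, $(\sigma_F\sigma_{F\alpha})^s=id$, and $(\sigma_F\sigma_{F'})^2=id$ for $F'\notin\{F,F\alpha\}$. The group $G(\mathcal{P})$ acts on $W$ by $\tau^{-1}\sigma_F\tau=\sigma_{F\tau}$. Then $2^{\mathcal{P},\mathcal{G}(s)}$ is the regular $(n+1)$-polytope with group $G(2^{\mathcal{P},\mathcal{G}(s)}):=W\rtimes G(\mathcal{P})=\langle\rho_0,\dots,\rho_n\rangle$,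 where $\rho_0:=\sigma_{F_0}$ and $\rho_i:=\tau_{i-1}$ for $1\leq i\leq n$. For the icosahedron, $G(\mathcal{P})$ is the Coxeter group $[3,5]$ of order $120$, there are $12$ vertices, and $\alpha=(\tau_0\tau_1\tau_2)^5$. Hypertopes and halving: for a group $H$ with subgroups $(H_i)_{i\in I}$, $\Gamma(H;(H_i)_{i\in I})$ is the incidence system whose elements of type $i$ are the right cosets of $H_i$, two elements being incident iff the cosets intersect. A flag is a set of pairwise incident elements and a chamber is a flag containing an element of every type. A regular hypertope is an incidence system in which every flag lies in a chamber (a geometry) and which is thin (every flag missing exactly one type lies in exactly two chambers), residually connected (every residue of rank at least $2$ has connected incidence graph) and flag-transitive (type-preserving automorphisms are transitive on flags of each given type). Its automorphism group here means the group of type-preserving automorphisms. For a regular $(n+1)$-polytope with group $\langle\rho_0,\dots,\rho_n\rangle$, the halving group is $\langle\tilde{\rho}_0,\rho_1,\dots,\rho_n\rangle$ with $\tilde{\rho}_0=\rho_0\rho_1\rho_0$; $H_i$ is the subgroup generated by all these generators except the $i$-th one ($\tilde{\rho}_0$ being number $0$). *)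

(* Defs.v *)
From HB Require Import structures.
From mathcomp Require Import all_boot generic_quotient.
From mathcomp Require Import boolp classical_sets functions cardinality.
From Stdlib Require Import Relation_Operators.

Set Implicit Arguments.
Unset Strict Implicit.
Unset Printing Implicit Defensive.

Local Open Scope classical_set_scope.
Local Open Scope group_scope.

(** * Subgroups, cosets *)

Section Subgroups.
Variable G : groupType.
Implicit Types (A S : set G) (g h : G).

Definition is_subgroup A :=
  [/\ A 1, (forall x y, A x -> A y -> A (x * y)) & (forall x, A x -> A x^-1)].

Definition generated S : set G := smallest is_subgroup S.

Lemma generated_subgroup S : is_subgroup (generated S).
Proof.
split=> [A [[]]//|x y xS yS A SA|x xS A SA]; have [[A1 AM AV] _] := SA.
- by apply: AM; [apply: xS|apply: yS].
- by apply: AV; apply: xS.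
Qed.

Definition normal_closure S : set G :=
  generated [set r ^ g | r in S & g in setT].

Definition rcoset A g : set G := [set a * g | a in A].

Lemma rcoset1 A : rcoset A 1 = A.
Proof.
apply/seteqP; split=> [x [a Aa <-]|x Ax]; first by rewrite mulg1.
by exists x => //; rewrite mulg1.
Qed.

Lemma rcosetM A g h : rcoset (rcoset A g) h = rcoset A (g * h).
Proof.
apply/seteqP; split=> [_ [_ [a Aa <-] <-]|_ [a Aa <-]].
- by exists a => //; rewrite mulgA.
- by exists (a * g); [exists a|rewrite mulgA].
Qed.

End Subgroups.

(* The subgroup generated by a family, as a group in its own right. *)
Section GeneratedGroup.
Variables (G : groupType) (I : Type) (f : I -> G).

Definition gen_group : Type := {x : G | x \in generated (range f)}.

HB.instance Definition _ := [isSub for (@sval _ _ : gen_group -> G)].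
HB.instance Definition _ := [Choice of gen_group by <:].

Lemma generated_closed : group_closed [pred x | x \in generated (range f)].
Proof.
have [A1 AM AV] := generated_subgroup (range f).
split=> [|x y]; rewrite !inE // => xA yA.
by apply: AM => //; apply: AV.
Qed.

HB.instance Definition _ :=
  SubChoice_isSubGroup.Build G _ gen_group generated_closed.

Lemma gen_elt_subproof i : f i \in generated (range f).
Proof. by apply/mem_set; apply: sub_gen_smallest; exists i. Qed.

Definition gen_elt (i : I) : gen_group := exist _ (f i) (gen_elt_subproof i).

End GeneratedGroup.

(** * Groups given by generators and relators *)

(* A letter (x, false) stands for x, and (x, true) for its inverse. *)
Definition word (X : Type) : Type := seq (X * bool).

Definition word_eval (X : Type) (G : groupType) (f : X -> G) (w : word X) : G :=
  \prod_(l <- w) (if l.2 then (f l.1)^-1 else f l.1).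

Definition word_inv (X : Type) (w : word X) : word X :=
  rev [seq (l.1, ~~ l.2) | l <- w].

Section WordEval.
Variables (X : Type) (G : groupType) (f : X -> G).

Lemma word_eval_nil : word_eval f [::] = 1.
Proof. by rewrite /word_eval big_nil. Qed.

Lemma word_eval_cat u v : word_eval f (u ++ v) = word_eval f u * word_eval f v.
Proof. by rewrite /word_eval big_cat. Qed.

Lemma word_eval1 x : word_eval f [:: (x, false)] = f x.
Proof. by rewrite /word_eval big_cons big_nil mulg1. Qed.

End WordEval.

Section Presented.
Variables (X : choiceType) (R : set (word X)).

(* The congruence on words whose quotient is the group <X | R>. *)
Inductive word_equiv : word X -> word X -> Prop :=
| word_equiv_refl u : word_equiv u u
| word_equiv_sym u v : word_equiv u v -> word_equiv v u
| word_equiv_trans v u w : word_equiv u v -> word_equiv v w -> word_equiv u w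
| word_equiv_cat u u' v v' :
    word_equiv u u' -> word_equiv v v' -> word_equiv (u ++ v) (u' ++ v')
| word_equiv_cancel x b : word_equiv [:: (x, b); (x, ~~ b)] [::]
| word_equiv_rel r : R r -> word_equiv r [::].

Definition word_equivb : rel (word X) := fun u v => `[< word_equiv u v >].

Lemma word_equivb_refl : reflexive word_equivb.
Proof. by move=> u; apply/asboolP/word_equiv_refl. Qed.
Lemma word_equivb_sym : symmetric word_equivb.
Proof. by move=> u v; apply/asboolP/asboolP => /word_equiv_sym. Qed.
Lemma word_equivb_trans : transitive word_equivb.
Proof.
move=> v u w /asboolP uv /asboolP vw.
exact/asboolP/(word_equiv_trans uv vw).
Qed.

Canonical word_equivb_equiv :=
  EquivRel word_equivb word_equivb_refl word_equivb_sym word_equivb_trans.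

Definition presented := {eq_quot word_equivb}%qT.

HB.instance Definition _ := Choice.on presented.

Definition word_class (w : word X) : presented := (\pi_presented w)%qT.

Lemma word_classP u v : word_class u = word_class v <-> word_equiv u v.
Proof.
by split=> [/eqmodP/asboolP//|uv]; apply/eqmodP/asboolP.
Qed.

Lemma word_class_surj (a : presented) : word_class (repr a) = a.
Proof. exact: reprK. Qed.

Lemma word_repr u : word_equiv (repr (word_class u)) u.
Proof. by apply/word_classP; rewrite word_class_surj. Qed.

Lemma word_equiv_invr w : word_equiv (w ++ word_inv w) [::].
Proof.
elim: w => [|[x b] w IH] /=; first exact: word_equiv_refl.
rewrite /word_inv /= rev_cons -cats1 catA -cat1s.
apply: (word_equiv_trans (v := [:: (x, b)] ++ ([::] ++ [:: (x, ~~ b)]))).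
  apply: word_equiv_cat; first exact: word_equiv_refl.
  by apply: word_equiv_cat => //; exact: word_equiv_refl.
exact: word_equiv_cancel.
Qed.

Lemma word_invK : involutive (@word_inv X).
Proof.
move=> w; rewrite /word_inv map_rev revK -map_comp -[RHS]map_id.
by apply: eq_map => -[x b] /=; rewrite negbK.
Qed.

Lemma word_equiv_invl w : word_equiv (word_inv w ++ w) [::].
Proof. by rewrite -{2}[w]word_invK; exact: word_equiv_invr. Qed.

Definition presented_mul (a b : presented) := word_class (repr a ++ repr b).
Definition presented_inv (a : presented) := word_class (word_inv (repr a)).

Lemma presented_mulE u v :
  presented_mul (word_class u) (word_class v) = word_class (u ++ v).
Proof. by apply/word_classP; apply: word_equiv_cat; exact: word_repr. Qed.

Lemma presented_mulA : associative presented_mul.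
Proof.
move=> a b c; rewrite -(word_class_surj a) -(word_class_surj b).
by rewrite -(word_class_surj c) !presented_mulE catA.
Qed.

Lemma presented_mul1 : left_id (word_class [::]) presented_mul.
Proof. by move=> a; rewrite -(word_class_surj a) presented_mulE. Qed.

Lemma presented_1mul : right_id (word_class [::]) presented_mul.
Proof. by move=> a; rewrite -(word_class_surj a) presented_mulE cats0. Qed.

Lemma presented_mulV :
  left_inverse (word_class [::]) presented_inv presented_mul.
Proof.
move=> a; rewrite -{2}(word_class_surj a) presented_mulE.
exact/word_classP/word_equiv_invl.
Qed.

Lemma presented_Vmul :
  right_inverse (word_class [::]) presented_inv presented_mul.
Proof.
move=> a; rewrite -{1}(word_class_surj a) presented_mulE.
exact/word_classP/word_equiv_invr.
Qed.

HB.instance Definition _ := isGroup.Build presented presented_mulA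
  presented_mul1 presented_1mul presented_mulV presented_Vmul.

Lemma word_class_cat u v : word_class (u ++ v) = word_class u * word_class v.
Proof. by rewrite -presented_mulE. Qed.

Lemma word_class_nil : word_class [::] = 1.
Proof. by []. Qed.

Definition presented_gen (x : X) : presented := word_class [:: (x, false)].

Lemma presented_genV x : (presented_gen x)^-1 = word_class [:: (x, true)].
Proof.
apply: mulg1_eq; rewrite -word_class_cat -word_class_nil.
by apply/word_classP; exact: (word_equiv_cancel x false).
Qed.

Lemma word_classE w : word_class w = word_eval presented_gen w.
Proof.
elim: w => [|[x b] w IH]; first by rewrite word_eval_nil.
rewrite -cat1s word_class_cat word_eval_cat IH; congr (_ * _).
by case: b; rewrite /word_eval big_cons big_nil /= mulg1 ?presented_genV.
Qed.

Lemma presented_relator r : R r -> word_eval presented_gen r = 1.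
Proof.
by move=> Rr; rewrite -word_classE -word_class_nil;
  apply/word_classP/word_equiv_rel.
Qed.

(* The homomorphism <X | R> -> G extending f; it is one only when f kills every
   relator. *)
Definition presented_lift (G : groupType) (f : X -> G) (a : presented) : G :=
  word_eval f (repr a).

Section Lift.
Variables (G : groupType) (f : X -> G).
Hypothesis fR : forall r, R r -> word_eval f r = 1.

Lemma word_eval_equiv u v : word_equiv u v -> word_eval f u = word_eval f v.
Proof.
elim=> // {u v}.
- by move=> v u w _ -> _ ->.
- by move=> u u' v v' _ IHu _ IHv; rewrite !word_eval_cat IHu IHv.
- move=> x b; rewrite word_eval_nil /word_eval !big_cons big_nil /= mulg1.
  by case: b => /=; rewrite ?mulVg ?mulgV.
- by move=> r Rr; rewrite fR // word_eval_nil.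
Qed.

Lemma presented_liftE w : presented_lift f (word_class w) = word_eval f w.
Proof. exact/word_eval_equiv/word_repr. Qed.

Lemma presented_liftM a b :
  presented_lift f (a * b) = presented_lift f a * presented_lift f b.
Proof.
rewrite -(word_class_surj a) -(word_class_surj b) -word_class_cat.
by rewrite !presented_liftE word_eval_cat.
Qed.

Lemma presented_lift_gen x : presented_lift f (presented_gen x) = f x.
Proof. by rewrite presented_liftE word_eval1. Qed.

End Lift.

Lemma presented_hom_ext (G : groupType) (p q : presented -> G) :
    {morph p : a b / a * b} -> {morph q : a b / a * b} ->
  (forall x, p (presented_gen x) = q (presented_gen x)) -> p =1 q.
Proof.
move=> pM qM pq.
have hom1 (r : presented -> G) : {morph r : a b / a * b} -> r 1 = 1.
  by move=> rM; apply: (mulgI (r 1)); rewrite -rM !mulg1.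
have homV (r : presented -> G) :
    {morph r : a b / a * b} -> forall a, r a^-1 = (r a)^-1.
  by move=> rM a; apply/esym/mulg1_eq; rewrite -rM mulgV hom1.
move=> a; rewrite -(word_class_surj a); elim: (repr a) => [|[x b] w IH].
  by rewrite word_class_nil !hom1.
rewrite -cat1s word_class_cat pM qM IH; congr (_ * _).
by case: b; rewrite -?presented_genV ?homV // pq.
Qed.

End Presented.

(** * Coxeter groups *)

Section Coxeter.
Variables (X : choiceType) (m : X -> X -> nat).

Definition coxeter_relator (x y : X) : word X :=
  flatten (nseq (m x y) [:: (x, false); (y, false)]).

Definition coxeter_relators : set (word X) :=
  [set r | exists x y, r = coxeter_relator x y].

(* (x y)^(m x y) = 1 for all x and y. In a Coxeter matrix m x x = 1, which
   yields x^2 = 1. *)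
Definition coxeter_group := presented coxeter_relators.

HB.instance Definition _ := Group.on coxeter_group.

Definition coxeter_gen : X -> coxeter_group :=
  presented_gen coxeter_relators.

Lemma word_eval_coxeter_relator (G : groupType) (f : X -> G) x y :
  word_eval f (coxeter_relator x y) = (f x * f y) ^+ m x y.
Proof.
rewrite /coxeter_relator; elim: (m x y) => [|k IH].
  by rewrite /= word_eval_nil.
rewrite expgS -IH -[flatten _]/([:: (x, false); (y, false)] ++ _).
by rewrite word_eval_cat {1}/word_eval !big_cons big_nil /= mulg1.
Qed.

Lemma coxeter_genE x y : (coxeter_gen x * coxeter_gen y) ^+ m x y = 1.
Proof.
rewrite -word_eval_coxeter_relator.
by apply: presented_relator; exists x, y.
Qed.

End Coxeter.

(** * Semidirect products *)

Record right_action (G W : groupType) := RightAction {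
  ract :> W -> G -> W;
  ractM : forall v w g, ract (v * w) g = ract v g * ract w g;
  ract1 : forall w, ract w 1 = w;
  ractA : forall w g h, ract w (g * h) = ract (ract w g) h
}.

(* The pair (g, w) stands for the product g w, and w^g = g^-1 w g. *)
Definition semidirect (G W : groupType) (a : right_action G W) : Type :=
  (G * W)%type.

Section Semidirect.
Variables (G W : groupType) (a : right_action G W).

HB.instance Definition _ := Choice.copy (semidirect a) (G * W)%type.

Definition sdmul (x y : semidirect a) : semidirect a :=
  (x.1 * y.1, a x.2 y.1 * y.2).
Definition sdone : semidirect a := (1, 1).
Definition sdinv (x : semidirect a) : semidirect a :=
  (x.1^-1, (a x.2 x.1^-1)^-1).

Lemma ract_one g : a 1 g = 1.
Proof. by apply: (mulgI (a 1 g)); rewrite -ractM !mulg1. Qed.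

Lemma ract_inv w g : a w^-1 g = (a w g)^-1.
Proof. by apply/esym/mulg1_eq; rewrite -ractM mulgV ract_one. Qed.

Lemma sdmulA : associative sdmul.
Proof.
by move=> x y z; rewrite /sdmul /= ractM -ractA !mulgA.
Qed.
Lemma sdmul1 : left_id sdone sdmul.
Proof. by case=> g w; rewrite /sdmul /= ract_one !mul1g. Qed.
Lemma sd1mul : right_id sdone sdmul.
Proof. by case=> g w; rewrite /sdmul /= ract1 !mulg1. Qed.
Lemma sdmulV : left_inverse sdone sdinv sdmul.
Proof.
by case=> g w; rewrite /sdmul /= ract_inv -ractA !mulVg ract1 mulVg.
Qed.
Lemma sdVmul : right_inverse sdone sdinv sdmul.
Proof. by case=> g w; rewrite /sdmul /= !mulgV. Qed.

HB.instance Definition _ := isGroup.Build (semidirect a)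
  sdmulA sdmul1 sd1mul sdmulV sdVmul.

Definition sdinl (g : G) : semidirect a := (g, 1).
Definition sdinr (w : W) : semidirect a := (1, w).

Lemma sdinrJ w g : (sdinr w) ^ (sdinl g) = sdinr (a w g).
Proof.
rewrite conjgE; congr pair => /=.
  by rewrite mul1g mulVg.
by rewrite !mulg1 ract_one invg1 ract_one mul1g.
Qed.

End Semidirect.

(** * The group of 2^(P,G(s)) and its halving group *)

(* The regular polytope P is given by its group G with generators tau; alpha is
   the central involution of G that acts as the central symmetry of P. *)
Section TwoPower.
Variables (G : groupType) (n : nat) (tau : 'I_n.+1 -> G) (alpha : G).
Hypothesis alphaC : forall g, commute alpha g.
Variable s : nat.

Definition vertex_stabilizer : set G :=
  generated (tau @` [set j | j != ord0]).

Definition is_vertex (F : set G) :=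
  exists g, F = rcoset vertex_stabilizer g.

Definition vertex : Type := set_type [set F | is_vertex F].

HB.instance Definition _ := Choice.on vertex.

Lemma is_vertex_rcoset (F : vertex) g :
  rcoset (val F) g \in [set F | is_vertex F].
Proof.
case: F => F /= /set_mem [h ->]; apply/mem_set.
by exists (h * g); rewrite rcosetM.
Qed.

Definition vact (F : vertex) (g : G) : vertex :=
  exist _ (rcoset (val F) g) (is_vertex_rcoset F g).

Lemma base_vertex_subproof : vertex_stabilizer \in [set F | is_vertex F].
Proof. by apply/mem_set; exists 1; rewrite rcoset1. Qed.

Definition base_vertex : vertex :=
  exist _ vertex_stabilizer base_vertex_subproof.

Lemma vact1 F : vact F 1 = F.
Proof. by apply: val_inj; rewrite /= rcoset1. Qed.

Lemma vactM F g h : vact F (g * h) = vact (vact F g) h.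
Proof. by apply: val_inj; rewrite /= rcosetM. Qed.

Lemma vact_inj g : injective (vact^~ g).
Proof.
by move=> F F' /(congr1 (vact^~ g^-1)); rewrite -!vactM mulgV !vact1.
Qed.

Definition vertex_matrix (F F' : vertex) : nat :=
  (if F' == F then 1 else if F' == vact F alpha then s else 2)%N.

Lemma vertex_matrixJ F F' g :
  vertex_matrix (vact F g) (vact F' g) = vertex_matrix F F'.
Proof.
rewrite /vertex_matrix (inj_eq (@vact_inj g)) -vactM -alphaC vactM.
by rewrite (inj_eq (@vact_inj g)).
Qed.

Definition vertex_group := coxeter_group vertex_matrix.

HB.instance Definition _ := Group.on vertex_group.

Definition sigma (F : vertex) : vertex_group := coxeter_gen vertex_matrix F.

Definition vertex_group_act (w : vertex_group) (g : G) : vertex_group :=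
  presented_lift (fun F => sigma (vact F g)) w.

Lemma sigma_act_relator g r : coxeter_relators vertex_matrix r ->
  word_eval (fun F => sigma (vact F g)) r = 1.
Proof.
move=> [F [F' ->]]; rewrite word_eval_coxeter_relator.
by rewrite -(vertex_matrixJ F F' g) coxeter_genE.
Qed.

Lemma vertex_group_act_sigma F g :
  vertex_group_act (sigma F) g = sigma (vact F g).
Proof.
by rewrite /vertex_group_act presented_lift_gen //; exact: sigma_act_relator.
Qed.

Lemma vertex_group_actM v w g : vertex_group_act (v * w) g =
  vertex_group_act v g * vertex_group_act w g.
Proof. by apply: presented_liftM; exact: sigma_act_relator. Qed.

Lemma vertex_group_act1 w : vertex_group_act w 1 = w.
Proof.
apply: (@presented_hom_ext _ _ vertex_group (vertex_group_act^~ 1) id) => //.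
- by move=> u v; exact: vertex_group_actM.
- by move=> F /=; rewrite vertex_group_act_sigma vact1.
Qed.

Lemma vertex_group_actA w g h : vertex_group_act w (g * h) =
  vertex_group_act (vertex_group_act w g) h.
Proof.
apply: (@presented_hom_ext _ _ vertex_group (vertex_group_act^~ (g * h))
  (fun w => vertex_group_act (vertex_group_act w g) h)).
- by move=> u v; exact: vertex_group_actM.
- by move=> u v /=; rewrite !vertex_group_actM.
- by move=> F /=; rewrite !vertex_group_act_sigma vactM.
Qed.

Definition vertex_action : right_action G vertex_group :=
  RightAction vertex_group_actM vertex_group_act1 vertex_group_actA.

Definition two_power_group := semidirect vertex_action.

HB.instance Definition _ := Group.on two_power_group.

Definition two_power_gen (i : 'I_n.+2) : two_power_group :=
  if unlift ord0 i is Some j then sdinl vertex_action (tau j)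
  else sdinr vertex_action (sigma base_vertex).

End TwoPower.

Section Halving.
Variables (G : groupType) (n : nat) (rho : 'I_n.+2 -> G).

Definition halving_family (i : 'I_n.+2) : G :=
  if i == ord0 then rho ord0 * rho (inord 1) * rho ord0 else rho i.

Definition halving_group := gen_group halving_family.

HB.instance Definition _ := Group.on halving_group.

Definition halving_gen : 'I_n.+2 -> halving_group := gen_elt halving_family.

Definition halving_parabolic (i : 'I_n.+2) : set halving_group :=
  generated (halving_gen @` [set j | j != i]).

End Halving.

Arguments halving_parabolic {G n} rho i.

(** * Incidence systems and hypertopes *)

Record incidence_system (I : Type) := IncidenceSystem {
  isys_elt :> Type;
  itype : isys_elt -> I;
  inc : isys_elt -> isys_elt -> Prop;
  inc_refl : forall x, inc x x;
  inc_sym : forall x y, inc x y -> inc y x;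
  inc_itype : forall x y, inc x y -> itype x = itype y -> x = y
}.

Section Hypertopes.
Variables (I : Type) (Gam : incidence_system I).
Implicit Types F C : set Gam.

Definition flag F := forall x y, F x -> F y -> inc x y.

Definition flag_type F : set I := @itype I Gam @` F.

Definition chamber C := flag C /\ flag_type C = setT.

Definition is_geometry := forall F, flag F -> exists C, chamber C /\ F `<=` C.

Definition is_thin := forall F i, flag F -> flag_type F = ~` [set i] ->
  exists C1 C2, C1 <> C2 /\
    forall C, chamber C /\ F `<=` C <-> C = C1 \/ C = C2.

Definition residue F : set Gam :=
  [set x | ~ F x /\ forall y, F y -> inc x y].

Definition inc_connected (A : set Gam) := forall x y, A x -> A y ->
  clos_refl_trans Gam (fun u v => [/\ A u, A v & inc u v]) x y.

(* The residue of F has the types outside flag_type F. *)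
Definition residually_connected := forall F, flag F ->
  (exists i j, [/\ i <> j, ~ flag_type F i & ~ flag_type F j]) ->
  inc_connected (residue F).

(* Type-preserving automorphisms. *)
Record taut := Taut {
  taut_fun :> Gam -> Gam;
  taut_bij : bijective taut_fun;
  taut_itype : forall x, itype (taut_fun x) = itype x;
  taut_inc : forall x y, inc (taut_fun x) (taut_fun y) <-> inc x y
}.

HB.instance Definition _ := gen_eqMixin taut.
HB.instance Definition _ := gen_choiceMixin taut.

Lemma taut_ext (a b : taut) : taut_fun a =1 taut_fun b -> a = b.
Proof.
case: a b => [f fb ft fi] [g gb gt gi] /= /funext fg; subst g.
by congr Taut; exact: Prop_irrelevance.
Qed.

Lemma taut_one_inc (x y : Gam) : inc (idfun x) (idfun y) <-> inc x y.
Proof. by []. Qed.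

Definition taut_one : taut :=
  Taut (Bijective (frefl _) (frefl _)) (fun=> erefl) taut_one_inc.

(* Automorphisms act on the right: first a, then b. *)
Definition taut_mul (a b : taut) : taut.
Proof.
refine (@Taut (taut_fun b \o taut_fun a) _ _ _).
- by apply: bij_comp; exact: taut_bij.
- by move=> x; rewrite /= !taut_itype.
- by move=> x y; rewrite /= !taut_inc.
Defined.

Lemma taut_inv_ex (a : taut) :
  exists b : taut, cancel a b /\ cancel b a.
Proof.
have [g fK gK] := taut_bij a.
have gt x : itype (g x) = itype x by rewrite -{2}(gK x) taut_itype.
have gi x y : inc (g x) (g y) <-> inc x y.
  by rewrite -(taut_inc a) !gK.
by exists (Taut (Bijective gK fK) gt gi).
Qed.

Definition taut_inv (a : taut) : taut := sval (cid (taut_inv_ex a)).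

Lemma taut_mulA : associative taut_mul.
Proof. by move=> a b c; apply: taut_ext. Qed.
Lemma taut_mul1 : left_id taut_one taut_mul.
Proof. by move=> a; apply: taut_ext. Qed.
Lemma taut_1mul : right_id taut_one taut_mul.
Proof. by move=> a; apply: taut_ext. Qed.
Lemma taut_mulV : left_inverse taut_one taut_inv taut_mul.
Proof.
move=> a; apply: taut_ext => x /=.
by rewrite /taut_inv; case: cid => b /= [ab ba]; rewrite ba.
Qed.
Lemma taut_Vmul : right_inverse taut_one taut_inv taut_mul.
Proof.
move=> a; apply: taut_ext => x /=.
by rewrite /taut_inv; case: cid => b /= [ab ba]; rewrite ab.
Qed.

HB.instance Definition _ := isGroup.Build taut
  taut_mulA taut_mul1 taut_1mul taut_mulV taut_Vmul.

Definition flag_transitive := forall F F', flag F -> flag F' ->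
  flag_type F = flag_type F' -> exists a : taut, a @` F = F'.

Definition regular_hypertope :=
  [/\ is_geometry, is_thin, residually_connected & flag_transitive].

End Hypertopes.

Section CosetSystem.
Variables (I : Type) (G : groupType) (K : I -> set G).
Hypothesis K_subgroup : forall i, is_subgroup (K i).

Record coset_elt := CosetElt {
  celt_type : I;
  celt_set : set G;
  celtP : exists g, celt_set = rcoset (K celt_type) g
}.

Definition coset_inc (x y : coset_elt) := celt_set x `&` celt_set y !=set0.

Lemma coset_inc_refl x : coset_inc x x.
Proof.
have [g eg] := celtP x; have [K1 _ _] := K_subgroup (celt_type x).
by exists g; rewrite setIid eg; exists 1; rewrite ?mul1g.
Qed.

Lemma coset_inc_sym x y : coset_inc x y -> coset_inc y x.
Proof. by case=> z [? ?]; exists z. Qed.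

Lemma rcoset_sub i g h z :
  rcoset (K i) g z -> rcoset (K i) h z -> rcoset (K i) g `<=` rcoset (K i) h.
Proof.
have [K1 KM KV] := K_subgroup i.
move=> [a Ka <-] [b Kb bh] _ [c Kc <-]; exists (c * (a^-1 * b)).
  by apply: (KM) => //; apply: KM => //; exact: KV.
by rewrite -!mulgA bh mulKg.
Qed.

Lemma coset_inc_type x y : coset_inc x y -> celt_type x = celt_type y -> x = y.
Proof.
case: x y => [i A Ag] [j B Bh] [z /= [Az Bz]] /= ij; subst j.
have AB : A = B.
  move: Ag Bh Az Bz => [g ->] [h ->] gz hz.
  by apply/seteqP; split; [exact: rcoset_sub gz hz|exact: rcoset_sub hz gz].
by subst B; congr CosetElt; exact: Prop_irrelevance.
Qed.

Definition coset_system : incidence_system I :=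
  IncidenceSystem coset_inc_refl coset_inc_sym coset_inc_type.

End CosetSystem.

Definition halving_parabolic_subgroup (G : groupType) (n : nat)
    (rho : 'I_n.+2 -> G) (i : 'I_n.+2) : is_subgroup (halving_parabolic rho i) :=
  generated_subgroup _.

Definition halving_system (G : groupType) (n : nat) (rho : 'I_n.+2 -> G) :
    incidence_system 'I_n.+2 :=
  coset_system (halving_parabolic_subgroup rho).

(** * The icosahedron *)

(* Coxeter matrix of the string diagram with branch labels p. *)
Definition string_matrix (p : seq nat) (i j : 'I_(size p).+1) : nat :=
  (if i == j then 1
  else if j == i.+1 :> nat then nth 2 p i
  else if i == j.+1 :> nat then nth 2 p j
  else 2)%N.

Definition ico_group := coxeter_group (string_matrix (p := [:: 3; 5])).

HB.instance Definition _ := Group.on ico_group.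

Definition ico_gen : 'I_3 -> ico_group :=
  coxeter_gen (string_matrix (p := [:: 3; 5])).

Definition ico_alpha : ico_group :=
  (ico_gen (inord 0) * ico_gen (inord 1) * ico_gen (inord 2)) ^+ 5.

(* ico_alpha is central: a chain of braid moves, checked by computation. *)
Section IcoCentral.
Variables (G : groupType) (x : nat -> G).

Let ev (w : seq nat) : G := \prod_(i <- w) x i.

Let rule (w : seq nat) : seq nat :=
  (match w with
  | [:: 0, 1, 0 & w'] => [:: 1, 0, 1 & w']
  | [:: 1, 0, 1 & w'] => [:: 0, 1, 0 & w']
  | [:: 0, 2 & w'] => [:: 2, 0 & w']
  | [:: 2, 0 & w'] => [:: 0, 2 & w']
  | [:: 1, 2, 1, 2, 1 & w'] => [:: 2, 1, 2, 1, 2 & w']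
  | [:: 2, 1, 2, 1, 2 & w'] => [:: 1, 2, 1, 2, 1 & w']
  | [:: 0, 0 & w'] => w'
  | [:: 1, 1 & w'] => w'
  | [:: 2, 2 & w'] => w'
  | _ => w
  end)%N.

Let move_at (w : seq nat) (k : nat) := take k w ++ rule (drop k w).

Hypothesis sq : forall i, i < 3 -> x i * x i = 1.
Hypothesis x01 : (x 0 * x 1) ^+ 3 = 1.
Hypothesis x12 : (x 1 * x 2) ^+ 5 = 1.
Hypothesis x02 : (x 0 * x 2) ^+ 2 = 1.

Let xV i : i < 3 -> (x i)^-1 = x i.
Proof. by move=> i3; apply: mulg1_eq; exact: sq. Qed.

Let ev_cons i w : ev (i :: w) = x i * ev w.
Proof. by rewrite /ev big_cons. Qed.

Let b01 : x 0 * (x 1 * x 0) = x 1 * (x 0 * x 1).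
Proof.
have e : x 0 * x 1 * (x 0 * x 1) = (x 0 * x 1)^-1.
  by apply/esym/mulg1_eq; rewrite -[RHS]x01 !expgS expg0 mulg1.
move/(congr1 (fun t => t * x 1)): e.
by rewrite invgM !xV // -!mulgA sq // mulg1.
Qed.

Let b02 : x 0 * x 2 = x 2 * x 0.
Proof.
have /mulg1_eq : x 0 * x 2 * (x 0 * x 2) = 1 by rewrite -expg2.
by rewrite invgM !xV // => ->.
Qed.

Let b12 : x 1 * (x 2 * (x 1 * (x 2 * x 1))) =
          x 2 * (x 1 * (x 2 * (x 1 * x 2))).
Proof.
have e : (x 1 * x 2) ^+ 3 = ((x 1 * x 2) ^+ 2)^-1.
  by apply/esym/mulg1_eq; rewrite -expgnDr.
move/(congr1 (fun t => t * x 2)): e.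
by rewrite !expgS expg0 !mulg1 !invgM !xV // -!mulgA sq // mulg1.
Qed.

Let ev_rule w : ev (rule w) = ev w.
Proof.
have B01 z : x 0 * (x 1 * (x 0 * z)) = x 1 * (x 0 * (x 1 * z)).
  by have := congr1 (mul^~ z) b01; rewrite -!mulgA.
have B02 z : x 0 * (x 2 * z) = x 2 * (x 0 * z).
  by have := congr1 (mul^~ z) b02; rewrite -!mulgA.
have B12 z : x 1 * (x 2 * (x 1 * (x 2 * (x 1 * z)))) =
             x 2 * (x 1 * (x 2 * (x 1 * (x 2 * z)))).
  by have := congr1 (mul^~ z) b12; rewrite -!mulgA.
have S i z : i < 3 -> x i * (x i * z) = z.
  by move=> i3; rewrite mulgA sq // mul1g.
rewrite /rule.
repeat match goal with
  | |- context [match ?v with _ => _ end] => is_var v; destruct v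
  end; rewrite // !ev_cons ?S ?B01 ?B02 ?B12 //.
Qed.

Let ev_moves w ks : ev (foldl move_at w ks) = ev w.
Proof.
elim: ks w => [|k ks IH] w //=; rewrite IH /move_at.
have ev_cat u v : ev (u ++ v) = ev u * ev v by rewrite /ev big_cat.
by rewrite ev_cat ev_rule -ev_cat cat_take_drop.
Qed.

Lemma ico_alpha_commute i : i < 3 ->
  commute ((x 0 * x 1 * x 2) ^+ 5) (x i).
Proof.
set w := [:: 0; 1; 2; 0; 1; 2; 0; 1; 2; 0; 1; 2; 0; 1; 2]%N.
have -> : (x 0 * x 1 * x 2) ^+ 5 = ev w.
  by rewrite /w !ev_cons /ev big_nil !expgS expg0 !mulg1 -!mulgA.
have evr u j : ev u * x j = ev (rcons u j).
  by rewrite -cats1 /ev big_cat big_seq1.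
rewrite /commute evr -ev_cons.
case: i => [|[|[|//]]] _.
- by rewrite -(ev_moves (rcons w 0) [:: 2; 8; 6; 14; 12; 8; 7; 3; 1; 3; 7; 9]%N)
    -(ev_moves (0 :: w)%N [::]).
- by rewrite -(ev_moves (rcons w 1%N) [:: 2; 0; 5; 11; 9; 11; 10; 6; 4; 6; 10; 12]%N)
    -(ev_moves (1 :: w)%N [::]).
- by rewrite -(ev_moves (rcons w 2) [:: 5; 3; 11; 9; 5; 4; 9; 10; 8; 7; 5; 1; 0;
    5; 10; 6; 4; 6; 10; 12]%N) -(ev_moves (2 :: w)%N [::]).
Qed.

End IcoCentral.

Lemma ico_alphaC (g : ico_group) : commute ico_alpha g.
Proof.
pose x i := ico_gen (inord i).
have rel i j : (x i * x j) ^+ string_matrix (p := [:: 3; 5]) (inord i) (inord j)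
    = 1 by exact: coxeter_genE.
have genC i : commute ico_alpha (ico_gen i).
  rewrite -[i]inord_val.
  apply: (@ico_alpha_commute _ x _ _ _ _ i (ltn_ord i)).
  - move=> j j3; have := rel j j.
    by rewrite /string_matrix eqxx expg1.
  - have := rel 0%N 1%N.
    by rewrite /string_matrix -val_eqE /= !inordK.
  - have := rel 1%N 2%N.
    by rewrite /string_matrix -val_eqE /= !inordK.
  - have := rel 0%N 2%N.
    by rewrite /string_matrix -val_eqE /= !inordK.
rewrite -(word_class_surj g) word_classE /word_eval; apply: commute_prod.
by case=> i [] _ //=; apply: commuteV; exact: genC.
Qed.

(* The distinguished generators of G(2^({3,5},G(s))). *)
Definition ico2_gen (s : nat) : 'I_4 -> two_power_group ico_gen ico_alphaC s :=
  two_power_gen ico_gen ico_alphaC s.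

(* Coxeter diagram underlying the presentation of H: nodes 0 and 1 are both joined to node 2
   with label 3, and node 2 is joined to node 3 with label 5. *)
Definition halving_ico_matrix (i j : 'I_4) : nat :=
  (match nat_of_ord i, nat_of_ord j with
  | 0, 2 | 2, 0 | 1, 2 | 2, 1 => 3
  | 2, 3 | 3, 2 => 5
  | _, _ => if i == j then 1 else 2
  end)%N.

(* Main.v *)
Require Import Defs.
From HB Require Import structures.
From mathcomp Require Import all_boot perm.
From mathcomp Require Import boolp classical_sets functions cardinality.
From Stdlib Require Import Relation_Operators.

(** Write G for the icosahedral Coxeter group [3,5], W for the group generated
    by the vertex reflections, F0 for the base vertex and S for its reflection.
    Since S conjugates the generator tau_0 of G to tau_0 times the product of
    two reflections, at adjacent vertices, and fixes tau_1 and tau_2, the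
    halving group H consists of the pairs (g, w) in the semidirect product of G
    and W with w of even length (even_val, val_even).

    Order. W is the direct product of the six dihedral groups of order 2 s
    generated by the pairs of antipodal vertices (of_coordinatesK,
    coordinatesK), and G has order 120 (ico_elt_inj, ico_elt_surj), so H has
    order 120 (2 s)^6 / 2.

    Hypertope. A coset geometry is a regular hypertope with automorphism group H
    as soon as the generators of H are involutions satisfying the intersection
    condition of C-groups and every flag of cosets has a common element
    (coset_regular_hypertope, coset_automorphism_group). In coordinates the
    maximal parabolic subgroups are G, its conjugate by S, and two subgroups
    that fix an edge or a triangle of the icosahedron and whose part in W is
    generated by the reflections at its vertices (halving_parabolicE). Both
    conditions then reduce to statements about G (parabolic_cap, tp_meet).
    Beyond the parity of lengths, the only input about W is that a reflection
    does not belong to the subgroup generated by other ones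
    (sigma_notin_generated), which its projections onto the dihedral factors
    show.

    Presentation. Both relators hold in H: they are powers of products of S with
    another reflection (tp_val_relator). Conversely, the presentation is
    invariant under exchanging the generators 0 and 1, so an involution r0
    inducing this symmetry can be adjoined to the presented group. As r0
    commutes with the images of tau_1 and tau_2, its conjugates under the image
    of G are indexed by the vertices. They satisfy the relations of W: up to the
    action of G a pair of vertices is an equal pair, a pair of neighbours, a
    pair of antipodes or a vertex and the antipode of a neighbour
    (ico_stab_orbits), and the relation for neighbours is the commutation of the
    generators 0 and 1, while the other two are the additional relators
    (vertex_image_relation). So the semidirect product of G and W maps to the
    extended presented group, and on generators this map undoes the map from the
    Coxeter group to H (tp_val_image); the kernel of the latter is therefore the
    normal closure of the relators.

    Facts about G are computed from its 120 normal forms and their faithful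
    action on the twelve vertices (ico_normal_form, ico_pt_inj). *)

Set Implicit Arguments.
Unset Strict Implicit.
Unset Printing Implicit Defensive.

Local Open Scope classical_set_scope.
Local Open Scope group_scope.

(** * Generated subgroups, morphisms and semidirect products *)

Section GeneratedTheory.
Variable G : groupType.
Implicit Types (A S : set G).

Lemma generated_min A S : is_subgroup A -> S `<=` A -> generated S `<=` A.
Proof. by move=> Agrp SA; apply: smallest_sub. Qed.

Lemma sub_generated S x : S x -> generated S x.
Proof. exact: sub_gen_smallest. Qed.

Lemma generated_mono S S' : S `<=` S' -> generated S `<=` generated S'.
Proof.
move=> SS'; apply: generated_min; first exact: generated_subgroup.
by move=> x /SS' /sub_generated.
Qed.

Lemma generated0 x : generated set0 x -> x = 1 :> G.
Proof.
apply: (@generated_min [set y | y = 1]) => //.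
by split=> [//|y z -> ->|y ->]; rewrite ?mulg1 ?invg1.
Qed.

Lemma generated_involution (t : G) x :
  t * t = 1 -> generated [set t] x -> x = 1 \/ x = t.
Proof.
move=> tt; apply: (@generated_min [set y | y = 1 \/ y = t]); last by move=> _ ->; right.
split=> [|y z [->|->] [->|->]|y [->|->]]; rewrite /= ?mulg1 ?mul1g ?invg1 ?tt;
  auto.
by right; apply: mulg1_eq.
Qed.

End GeneratedTheory.

Section Morphisms.
Variables (G H : groupType) (f : G -> H).
Hypothesis fM : {morph f : x y / x * y}.

Lemma morph_one : f 1 = 1.
Proof. by apply: (mulgI (f 1)); rewrite -fM !mulg1. Qed.

Lemma morph_inv x : f x^-1 = (f x)^-1.
Proof. by apply/esym/mulg1_eq; rewrite -fM mulgV morph_one. Qed.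

Lemma morph_exp x k : f (x ^+ k) = f x ^+ k.
Proof. by elim: k => [|k IH]; rewrite ?expg0 ?morph_one // !expgS fM IH. Qed.

Lemma preimage_subgroup (A : set H) : is_subgroup A -> is_subgroup (f @^-1` A).
Proof.
case=> A1 AM AV; split=> /= [|x y|x]; rewrite ?morph_one ?fM ?morph_inv //.
  exact: AM.
exact: AV.
Qed.

End Morphisms.

Section GenGroup.
Variables (G : groupType) (I : Type) (f : I -> G).
Local Notation H := (gen_group f).

Lemma gen_group_generated (A : set I) (x : H) :
  generated (gen_elt f @` A) x <-> generated (f @` A) (val x).
Proof.
have valM : {morph (val : H -> G) : x y / x * y} by [].
split.
  move: x; apply: generated_min.
    by apply: preimage_subgroup => //; exact: generated_subgroup.
  by move=> _ [i Ai <-]; apply: sub_generated; exists i.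
have [S1 SM SV] := generated_subgroup (gen_elt f @` A).
suff lift y : generated (f @` A) y ->
    exists x' : H, val x' = y /\ generated (gen_elt f @` A) x'.
  by move=> /lift [x' [/val_inj ->]].
move: y; apply: generated_min.
  split=> [|_ _ [y [<- Sy]] [z [<- Sz]]|_ [y [<- Sy]]].
  - by exists 1.
  - by exists (y * z); split=> //; exact: SM.
  - by exists y^-1; split=> //; exact: SV.
by move=> _ [i Ai <-]; exists (gen_elt f i); split=> //; apply: sub_generated; exists i.
Qed.

Lemma gen_groupP y : generated (range f) y -> exists x : H, val x = y.
Proof. by move=> fy; exists (exist _ y (mem_set fy)). Qed.

End GenGroup.

Section SemidirectTheory.
Variables (G W : groupType) (a : right_action G W).
Local Notation SD := (semidirect a).
Implicit Types x y : SD.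

Lemma sd_mul1 x y : (x * y).1 = x.1 * y.1. Proof. by []. Qed.

Lemma sd_mul2 x y : (x * y).2 = a x.2 y.1 * y.2. Proof. by []. Qed.

Lemma sd_inv1 x : (x^-1).1 = x.1^-1. Proof. by []. Qed.

Lemma sd_inv2 x : (x^-1).2 = a (x.2)^-1 x.1^-1.
Proof. by rewrite ract_inv. Qed.

Lemma sd_ext x y : x.1 = y.1 -> x.2 = y.2 -> x = y.
Proof. by case: x y => g v [h w] /= -> ->. Qed.

Lemma sd_split x : x = sdinl a x.1 * sdinr a x.2.
Proof. by apply: sd_ext; rewrite ?sd_mul1 ?sd_mul2 /= ?mulg1 ?ract1 ?mul1g. Qed.

Lemma sd_fst g w : (sdinl a g * sdinr a w).1 = g.
Proof. by rewrite sd_mul1 mulg1. Qed.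

Lemma sd_snd g w : (sdinl a g * sdinr a w).2 = w.
Proof. by rewrite sd_mul2 ract_one mul1g. Qed.

Lemma sdinlM : {morph sdinl a : g h / g * h}.
Proof. by move=> g h; apply: sd_ext; rewrite //= ract_one mulg1. Qed.

Lemma sdinrM : {morph sdinr a : v w / v * w}.
Proof. by move=> v w; apply: sd_ext; rewrite /= ?ract1 ?mulg1. Qed.

Lemma sdinr_inl w g : sdinr a w * sdinl a g = sdinl a g * sdinr a (a w g).
Proof. by apply: sd_ext; rewrite /= ?ract1 ?(mulg1, mul1g). Qed.

End SemidirectTheory.

(** * Coset geometries with the intersection condition *)

(** A set of cosets with a common element x lies in the chamber formed by the
    cosets of x. Once every flag has a common element (flag_common), all
    questions about flags are questions about intersections of the K j, and the
    intersection condition K_cap of a C-group answers them. *)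
Section CosetGeometry.
Variables (I : Type) (G : groupType) (K : I -> set G) (t : I -> G).
Hypothesis K_subgroup : forall i, is_subgroup (K i).
Hypothesis tK : forall i j, i <> j -> K j (t i).
Hypothesis t_sq : forall i, t i * t i = 1.
Hypothesis t_neq1 : forall i, t i <> 1.
Hypothesis K_cap : forall (J : set I) x,
  (forall j, J j -> K j x) -> generated (t @` ~` J) x.

Local Notation Gam := (coset_system K_subgroup).
Implicit Types (F C : set Gam) (A B : Gam) (x y z : G).

Hypothesis flag_common :
  forall F, flag F -> exists x, forall A, F A -> celt_set A x.

Let K1 i : K i 1. Proof. by case: (K_subgroup i). Qed.
Definition coset_at i x : Gam :=
  CosetElt (ex_intro _ x erefl : exists g, rcoset (K i) x = rcoset (K i) g).

Lemma rcosetP (S : set G) x y : rcoset S x y <-> S (y * x^-1).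
Proof.
split=> [[a Sa <-]|Syx]; first by rewrite mulgK.
by exists (y * x^-1); rewrite ?mulgVK.
Qed.

Lemma coset_at_mem i x y : celt_set (coset_at i x) y <-> K i (y * x^-1).
Proof. exact: rcosetP. Qed.

Lemma coset_at_refl i x : celt_set (coset_at i x) x.
Proof. by apply/coset_at_mem; rewrite mulgV. Qed.

Lemma coset_at_inc i j x : inc (coset_at i x) (coset_at j x).
Proof. by exists x; split; apply: coset_at_refl. Qed.

Lemma coset_atE A x : celt_set A x -> A = coset_at (itype A) x.
Proof.
move=> Ax; apply: (@inc_itype _ Gam) => //.
by exists x; split=> //; apply: coset_at_refl.
Qed.

Lemma coset_at_eq i x y : coset_at i x = coset_at i y <-> K i (y * x^-1).
Proof.
rewrite -coset_at_mem; split=> [->|/coset_atE//]; exact: coset_at_refl.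
Qed.

Definition chamber_at x : set Gam := [set A | celt_set A x].

Lemma chamber_at_flag x : flag (chamber_at x).
Proof. by move=> A B Ax Bx; exists x. Qed.

Lemma chamber_at_chamber x : chamber (chamber_at x).
Proof.
split; first exact: chamber_at_flag.
by apply/seteqP; split=> // i _; exists (coset_at i x) => //; apply: coset_at_refl.
Qed.

Lemma chamberP C : chamber C -> exists x, C = chamber_at x.
Proof.
case=> /flag_common [x Cx] CT; exists x; apply/seteqP; split=> // A Ax.
have [B CB BA] : flag_type C (itype A) by rewrite CT.
suff -> : A = B by [].
by rewrite (coset_atE Ax) (coset_atE (Cx _ CB)) BA.
Qed.

Lemma cap_all x : (forall i, K i x) -> x = 1.
Proof.
move=> Kx; apply: generated0; have := @K_cap setT x (fun i _ => Kx i).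
by rewrite setCT image_set0.
Qed.

Lemma gen_notin i : ~ K i (t i).
Proof.
move=> Ki; apply: (@t_neq1 i); apply: cap_all => j.
have [<-//|ij] := pselect (i = j); exact: tK.
Qed.

(** The reason for thinness: away from i the K j meet in the group of order two
    generated by t i. *)
Lemma cap_but x y i : (forall j, j <> i -> K j (y * x^-1)) ->
  y = x \/ y = t i * x.
Proof.
move=> Kyx; have : generated [set t i] (y * x^-1).
  by have := @K_cap (~` [set i]) _ Kyx; rewrite setCK image_set1.
case/(generated_involution (t_sq i)) => e; [left|right].
  by rewrite -[y](mulgVK x) e mul1g.
by rewrite -e mulgVK.
Qed.

Lemma coset_geometry : is_geometry Gam.
Proof.
move=> F /flag_common [x Fx]; exists (chamber_at x).
by split=> //; exact: chamber_at_chamber.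
Qed.

Lemma coset_thin : is_thin Gam.
Proof.
move=> F i fF FT; have [x Fx] := flag_common fF.
exists (chamber_at x), (chamber_at (t i * x)); split.
  move=> E; have : chamber_at x (coset_at i x) by apply: coset_at_refl.
  rewrite E => /coset_at_mem; rewrite mulgK; exact: gen_notin.
move=> C; split=> [[/chamberP [y ->] Fy]|].
  have /cap_but [->|->] : forall j, j <> i -> K j (y * x^-1); [|by left|by right].
  move=> j ji; have [A FA Aj] : flag_type F j by rewrite FT.
  by apply/coset_at_mem; rewrite -Aj -(coset_atE (Fx _ FA)); exact: Fy.
case=> ->; (split; first exact: chamber_at_chamber) => // A FA.
have Ai : itype A <> i.
  by have : flag_type F (itype A) by [exists A]; rewrite FT.
rewrite (coset_atE (Fx _ FA)); apply/coset_at_mem; rewrite mulgK.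
by apply: tK => /esym.
Qed.

Lemma residue_at F y i : (forall A, F A -> celt_set A y) ->
  ~ flag_type F i -> residue F (coset_at i y).
Proof.
move=> Fy Fi; split=> [Fc|A FA]; first by apply: Fi; exists (coset_at i y).
by exists y; split; [apply: coset_at_refl|apply: Fy].
Qed.

Lemma residueP F A : flag F -> residue F A ->
  exists y, [/\ forall B, F B -> celt_set B y, A = coset_at (itype A) y
    & ~ flag_type F (itype A)].
Proof.
move=> fF [nFA incA].
have /flag_common [y Ay] : flag (F `|` [set A]).
  move=> B C [FB|->] [FC|->]; [exact: fF|exact/inc_sym/incA|exact: incA|].
  exact: inc_refl.
exists y; split=> [B FB||[B FB BA]]; first by apply: Ay; left.
  by apply: coset_atE; apply: Ay; right.
by apply: nFA; rewrite -(inc_itype (inc_sym (incA _ FB)) BA).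
Qed.

(** Multiplying by a generator t k changes only the coset of type k, so a word
    in the generators whose types are missing from the flag describes a walk in
    its residue. *)
Lemma coset_residually_connected : residually_connected Gam.
Proof.
move=> F fF [i0 [j0 [ij0 Fi0 Fj0]]] A A' /(residueP fF) [y [Fy -> FA]].
move=> /(residueP fF) [y' [Fy' -> FA']].
pose J := flag_type F.
pose P x := forall B, F B -> celt_set B x.
pose conn x x' := forall i j, ~ J i -> ~ J j -> clos_refl_trans Gam
  (fun u v => [/\ residue F u, residue F v & inc u v])
  (coset_at i x) (coset_at j x').
have conn_refl x : P x -> conn x x.
  move=> Px i j Ji Jj; apply: rt_step.
  by split; [apply: residue_at|apply: residue_at|apply: coset_at_inc].
have conn_trans x2 x1 x3 : conn x1 x2 -> conn x2 x3 -> conn x1 x3.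
  by move=> c12 c23 i j Ji Jj; apply: rt_trans (c12 _ i0 _ _) (c23 _ _ _ _).
pose M z := forall x, P x -> P (z * x) /\ conn x (z * x).
suff My : [set z | M z /\ M z^-1] (y' * y^-1).
  by have [_] := proj1 My y Fy; rewrite mulgVK; apply.
apply: (@generated_min _ _ (t @` ~` J)); last 1 first.
- apply: K_cap => j [B FB Bj]; rewrite -coset_at_mem -Bj.
  by rewrite -(coset_atE (Fy _ FB)); exact: Fy'.
- split=> /= [|u v [Mu Mu'] [Mv Mv']|u [Mu Mu']]; last by rewrite invgK.
    by rewrite invg1; split=> x Px; rewrite mul1g; split=> //; apply: conn_refl.
  rewrite invgM; split=> x Px; rewrite -mulgA.
    have [Pv cv] := Mv _ Px; have [Pu cu] := Mu _ Pv.
    by split=> //; apply: conn_trans cv cu.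
  have [Pu cu] := Mu' _ Px; have [Pv cv] := Mv' _ Pu.
  by split=> //; apply: conn_trans cu cv.
- move=> _ [k Jk <-] /=; have -> : (t k)^-1 = t k by apply: mulg1_eq.
  suff Mk : M (t k) by [].
  move=> x Px.
  have eqk l : l <> k -> coset_at l x = coset_at l (t k * x).
    by move=> lk; apply/coset_at_eq; rewrite mulgK; apply: tK => /esym.
  have Pk : P (t k * x).
    move=> B FB; rewrite (coset_atE (Px _ FB)) eqk; first exact: coset_at_refl.
    by move=> Bk; apply: Jk; exists B.
  split=> //.
  (* any free type other than k has the same coset on both sides *)
  have [l Jl lk] : exists2 l, ~ J l & l <> k.
    have [e|] := pselect (i0 = k); last by exists i0.
    by exists j0 => // e'; apply: ij0; rewrite e e'.
  move=> i j Ji Jj; apply: rt_trans (conn_refl _ Px i l Ji Jl) _.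
  by rewrite eqk //; apply: conn_refl.
Qed.

Lemma translate_subproof g A :
  exists x, rcoset (celt_set A) g = rcoset (K (celt_type A)) x.
Proof. by have [x ->] := celtP A; exists (x * g); rewrite rcosetM. Qed.

Definition translate g A : Gam := CosetElt (translate_subproof g A).

Lemma translate_at g i x : translate g (coset_at i x) = coset_at i (x * g).
Proof.
apply: (@inc_itype _ Gam) => //; exists (x * g); split; last exact: coset_at_refl.
by apply/rcosetP; rewrite mulgK; exact: coset_at_refl.
Qed.

Lemma coset_at_surj A : exists i x, A = coset_at i x.
Proof.
have [x /coset_atE ->] : exists x, celt_set A x.
  by have [x ->] := celtP A; exists x; apply/rcosetP; rewrite mulgV.
by exists (itype A), x.
Qed.

Lemma translateM g g' A : translate (g * g') A = translate g' (translate g A).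
Proof.
by have [i [x ->]] := coset_at_surj A; rewrite !translate_at mulgA.
Qed.

Lemma translate1 A : translate 1 A = A.
Proof. by have [i [x ->]] := coset_at_surj A; rewrite translate_at mulg1. Qed.

Lemma translate_bij g : bijective (translate g).
Proof.
by exists (translate g^-1) => A; rewrite -translateM ?mulgV ?mulVg translate1.
Qed.

Lemma translate_inc1 g A B : inc A B -> inc (translate g A) (translate g B).
Proof.
by case=> x [Ax Bx]; exists (x * g); split; apply/rcosetP; rewrite mulgK.
Qed.

Lemma translate_inc g A B : inc (translate g A) (translate g B) <-> inc A B.
Proof.
split; last exact: translate_inc1.
move/(@translate_inc1 g^-1); rewrite -!translateM mulgV.
by rewrite !translate1.
Qed.

Definition translation g : taut Gam :=
  @Taut _ Gam (translate g) (translate_bij g) (fun=> erefl) (translate_inc g).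

Lemma translationM g g' : translation (g * g') = translation g * translation g'.
Proof. by apply: taut_ext => A; exact: translateM. Qed.

Lemma coset_flag_transitive : flag_transitive Gam.
Proof.
move=> F F' /flag_common [x Fx] /flag_common [y Fy] FF'.
exists (translation (x^-1 * y)).
have tr A : celt_set A x -> translate (x^-1 * y) A = coset_at (itype A) y.
  by move/coset_atE => {1}->; rewrite translate_at mulVKg.
apply/seteqP; split=> [_ [A FA <-]|B FB].
  have [B FB BA] : flag_type F' (itype A) by rewrite -FF'; exists A.
  suff -> : translation (x^-1 * y) A = B by [].
  by rewrite /= tr; [rewrite -BA -(coset_atE (Fy _ FB))|apply: Fx].
have [A FA AB] : flag_type F (itype B) by rewrite FF'; exists B.
exists A => //=; rewrite tr ?AB; last exact: Fx.
by rewrite -(coset_atE (Fy _ FB)).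
Qed.

Theorem coset_regular_hypertope : regular_hypertope Gam.
Proof.
split; [exact: coset_geometry|exact: coset_thin|
  exact: coset_residually_connected|exact: coset_flag_transitive].
Qed.

(** By thinness an automorphism that fixes the chamber of x fixes its
    neighbours, the chambers of the t k * x, and the t k generate the group. *)
Lemma taut_fix_chamber (b : taut Gam) :
  (forall i, b (coset_at i 1) = coset_at i 1) -> b = 1.
Proof.
move=> b1; pose fixed x := forall i, b (coset_at i x) = coset_at i x.
have stepf k x : fixed x -> fixed (t k * x).
  move=> fx.
  have eqk l : l <> k -> coset_at l x = coset_at l (t k * x).
    by move=> lk; apply/coset_at_eq; rewrite mulgK; apply: tK => /esym.
  have fk l : l <> k -> b (coset_at l (t k * x)) = coset_at l (t k * x).
    by move=> lk; rewrite -eqk.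
  suff fkk : b (coset_at k (t k * x)) = coset_at k (t k * x).
    by move=> i; have [->|] := pselect (i = k); [exact: fkk|exact: fk].
  have /flag_common [z bz] : flag [set b (coset_at i (t k * x)) | i in setT].
    move=> _ _ [i _ <-] [j _ <-]; apply/taut_inc; exact: coset_at_inc.
  have bzE i : b (coset_at i (t k * x)) = coset_at i z.
    have /coset_atE -> : celt_set (b (coset_at i (t k * x))) z by apply: bz; exists i.
    by rewrite taut_itype.
  have /cap_but [ez|ez] : forall j, j <> k -> K j (z * x^-1).
  - by move=> j jk; apply/coset_at_eq; rewrite -bzE fk // eqk.
  - have : coset_at k (t k * x) = coset_at k x.
      by apply: (bij_inj (taut_bij b)); rewrite bzE ez fx.
    move/esym/coset_at_eq; rewrite mulgK => /gen_notin [].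
  - by rewrite bzE ez.
have all_fixed x : fixed x.
  rewrite -[x]mulg1; move: (b1); rewrite -/(fixed 1).
  suff : [set z | forall y, fixed y <-> fixed (z * y)] x by move=> /(_ 1) [+ _].
  apply: (@generated_min _ _ (t @` ~` set0)); last exact: K_cap.
    split=> [y|u v fu fv y|u fu y] /=; first by rewrite mul1g.
      by rewrite -mulgA -fu -fv.
    by rewrite (fu (u^-1 * y)) mulVKg.
  move=> _ [k _ <-] y; split=> [|/(@stepf k)]; first exact: stepf.
  by rewrite mulgA t_sq mul1g.
apply: taut_ext => A; have [i [x ->]] := coset_at_surj A.
exact: all_fixed.
Qed.

Lemma translation_inj : injective translation.
Proof.
move=> g g' e; apply/esym; rewrite -[g'](mulgVK g).
have -> : g' * g^-1 = 1; last by rewrite mul1g.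
apply: cap_all => i; apply/coset_at_eq.
have := congr1 (fun a : taut Gam => a (coset_at i 1)) e.
by rewrite /= !translate_at !mul1g.
Qed.

(** An automorphism maps the chamber of 1 to the chamber of some x, as does the
    translation by x; the two differ by an automorphism that fixes a chamber. *)
Lemma translation_surj (a : taut Gam) : exists g, translation g = a.
Proof.
have /flag_common [x ax] : flag [set a (coset_at i 1) | i in setT].
  move=> _ _ [i _ <-] [j _ <-]; apply/taut_inc; exact: coset_at_inc.
have axE i : a (coset_at i 1) = coset_at i x.
  have /coset_atE -> : celt_set (a (coset_at i 1)) x by apply: ax; exists i.
  by rewrite taut_itype.
exists x; have : a * translation x^-1 = 1.
  by apply: taut_fix_chamber => i; rewrite /= axE translate_at mulgV.
move/(congr1 (fun b => b * translation x)); rewrite -mulgA -translationM mulVg.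
have -> : translation 1 = 1 by apply: taut_ext => A; exact: translate1.
by rewrite mulg1 mul1g => <-.
Qed.

HB.instance Definition _ :=
  isMultiplicative.Build G (taut Gam) translation translationM.

Theorem coset_automorphism_group :
  exists phi : {multiplicative G -> taut Gam}, bijective phi /\
    forall g A, itype (phi g A) = itype A /\
      celt_set (phi g A) = rcoset (celt_set A) g.
Proof.
exists translation; split=> //.
have g_of (a : taut Gam) := cid (translation_surj a).
exists (fun a => sval (g_of a)) => [g|a]; last exact: svalP (g_of a).
by apply: translation_inj; exact: svalP (g_of _).
Qed.

End CosetGeometry.

Section FlagCommon.
Variables (n : nat) (G : groupType) (K : 'I_n -> set G).
Hypothesis K_subgroup : forall i, is_subgroup (K i).
Hypothesis K_meet : forall (l : 'I_n) (J : set 'I_n) x,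
  (forall j, J j -> (j < l)%N) ->
  (forall j, J j -> exists u, K j u /\ K l (u * x^-1)) ->
  exists z, K l (z * x^-1) /\ forall j, J j -> K j z.

(** The elements of a flag are added in the order of their types. Translating by
    an element common to those of smaller type turns the claim about the next
    one into K_meet. *)
Lemma flag_common_ordinal (F : set (coset_system K_subgroup)) :
  flag F -> exists x, forall A, F A -> celt_set A x.
Proof.
move=> fF.
suff main m : (m <= n)%N -> exists x, forall A, F A -> (itype A < m)%N -> celt_set A x.
  by have [x Fx] := main n (leqnn n); exists x => A FA; apply: Fx.
elim: m => [|m IH] mn; first by exists 1.
have [y Fy] := IH (ltnW mn); pose l := Ordinal mn.
have [[A [FA Al]]|nA] := pselect (exists A, F A /\ itype A = l); last first.
  exists y => A FA; rewrite ltnS leq_eqVlt => /orP[/eqP e|]; last exact: Fy.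
  by case: nA; exists A; split=> //; apply: val_inj.
have [a Aa] : exists a, celt_set A a.
  have [a ->] := celtP A; exists a; apply/rcosetP; rewrite mulgV.
  by case: (K_subgroup (celt_type A)).
pose J : set 'I_n := [set j : 'I_n | (j < m)%N /\ flag_type F j].
have eqA i : itype A = i -> A = coset_at K_subgroup i a.
  by move=> <-; exact: coset_atE.
have [|j [jm [B FB Bj]]|z [za zJ]] := @K_meet l J (a * y^-1).
- by move=> j [].
- have Bm : (itype B < m)%N by rewrite Bj.
  have [v [Av Bv]] := fF _ _ FA FB; exists (v * y^-1); split.
    by rewrite -(coset_at_mem K_subgroup) -Bj -(coset_atE (Fy _ FB Bm)).
  by rewrite invgM invgK mulgA mulgVK -(coset_at_mem K_subgroup) -eqA.
exists (z * y) => B FB; rewrite ltnS leq_eqVlt => /orP[/eqP e|Bm].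
  have -> : B = A.
    apply: (inc_itype (fF _ _ FB FA)); rewrite Al; exact: val_inj.
  rewrite (eqA _ Al); apply/coset_at_mem.
  by move: za; rewrite invgM invgK mulgA.
rewrite (coset_atE (Fy _ FB Bm)); apply/coset_at_mem; rewrite mulgK.
by apply: zJ; split=> //; exists B.
Qed.

End FlagCommon.

(** * The group [3,5] and its action on the vertices of the icosahedron *)

(** The Knuth-Bendix completion of the relations of [3,5] for the
    length-lexicographic order in which 2 < 1 < 0. Normal forms are therefore
    reduced words. *)
Definition ico_rules : seq (seq nat * seq nat) :=
  [:: ([:: 0; 0], [::]); ([:: 1; 1], [::]); ([:: 2; 2], [::]);
      ([:: 0; 2], [:: 2; 0]); ([:: 0; 1; 0], [:: 1; 0; 1]);
      ([:: 1; 2; 1; 2; 1], [:: 2; 1; 2; 1; 2]);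
      ([:: 0; 1; 2; 0], [:: 1; 0; 1; 2]);
      ([:: 0; 1; 2; 1; 0; 1], [:: 1; 0; 1; 2; 1; 0]);
      ([:: 0; 1; 2; 1; 2; 0; 1; 2; 1; 2],
       [:: 1; 0; 1; 2; 1; 2; 0; 1; 2; 1])]%N.

Fixpoint rewrite_head (rs : seq (seq nat * seq nat)) (w : seq nat) :=
  if rs is (l, r) :: rs' then
    if prefix l w then r ++ drop (size l) w else rewrite_head rs' w
  else w.

Fixpoint rewrite_pass (w : seq nat) :=
  if w is i :: w' then rewrite_head ico_rules (i :: rewrite_pass w') else [::].

(** The longest element has length 15, so the words that are reduced below have
    at most 16 letters. *)
Definition ico_reduce (w : seq nat) := iter 16 rewrite_pass w.

(** The dihedral stabilizer of the base vertex, of order 10. *)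
Definition base_stab_words : seq (seq nat) :=
  [:: [::]; [:: 2]; [:: 1]; [:: 2; 1]; [:: 1; 2]; [:: 2; 1; 2]; [:: 1; 2; 1];
      [:: 2; 1; 2; 1]; [:: 1; 2; 1; 2]; [:: 2; 1; 2; 1; 2]]%N.

(** The shortest representatives of the cosets of the base vertex stabilizer. *)
Definition vertex_words : seq (seq nat) :=
  [:: [::]; [:: 0]; [:: 0; 1]; [:: 0; 1; 2]; [:: 0; 1; 2; 1];
      [:: 0; 1; 2; 1; 0]; [:: 0; 1; 2; 1; 2]; [:: 0; 1; 2; 1; 2; 0];
      [:: 0; 1; 2; 1; 2; 0; 1]; [:: 0; 1; 2; 1; 2; 0; 1; 2];
      [:: 0; 1; 2; 1; 2; 0; 1; 2; 1]; [:: 0; 1; 2; 1; 2; 0; 1; 2; 1; 0]]%N.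

Definition ico_words : seq (seq nat) :=
  [seq d ++ u | d <- base_stab_words, u <- vertex_words].

Lemma ico_words_closed :
  all (fun w => all (fun j => ico_reduce (rcons w j) \in ico_words) [:: 0; 1; 2]%N)
    ico_words.
Proof. by vm_compute. Qed.

(** The generators as permutations of the vertices, numbered so that 0 is the
    base vertex and 2 i and 2 i + 1 are antipodal. *)
Definition ico_move (j v : nat) : nat :=
  nth v (nth [::] [:: [:: 2; 3; 0; 1; 4; 5; 6; 7; 10; 11; 8; 9];
                      [:: 0; 1; 4; 5; 2; 3; 8; 9; 6; 7; 10; 11];
                      [:: 0; 1; 2; 3; 6; 7; 4; 5; 11; 10; 9; 8]]%N j) v.

Definition ico_act (w : seq nat) (v : nat) : nat :=
  foldl (fun v j => ico_move j v) v w.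

Lemma ico_words_faithful :
  uniq [seq [seq ico_act w v | v <- iota 0 12] | w <- ico_words].
Proof. by vm_compute. Qed.

(** The vertices of the base vertex, base edge and base triangle, whose
    stabilizers are the maximal parabolic subgroups. *)
Definition face_points (j : nat) : seq nat :=
  nth [::] [:: [:: 0]; [:: 0; 2]; [:: 0; 2; 4]]%N j.

(** A reduced word for an element of a parabolic subgroup uses only the letters
    of that subgroup; hence one list of normal forms settles all intersections
    at once. *)
Lemma ico_words_parabolic :
  all (fun w => all (fun j =>
      all (fun v => ico_act w v \in face_points j) (face_points j)
        ==> (j \notin w)) [:: 0; 1; 2]%N)
    ico_words.
Proof. by vm_compute. Qed.

Lemma ico_words_letters : all (all (fun i => i < 3)) ico_words.
Proof. by vm_compute. Qed.

Lemma face_points_stable :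
  all (fun j => all (fun i => (i == j) ||
    all (fun v => ico_move i v \in face_points j) (face_points j))
      [:: 0; 1; 2]%N) [:: 0; 1; 2]%N.
Proof. by vm_compute. Qed.

Lemma uniq_map_inj (S T : eqType) (f : S -> T) (r : seq S) :
  uniq (map f r) -> {in r &, injective f}.
Proof.
elim: r => //= a r IH /andP[na /IH inj] x y; rewrite !inE.
move=> /predU1P[->|xr] /predU1P[->|yr] // e; last exact: inj.
  by rewrite e map_f in na.
by rewrite -e map_f in na.
Qed.

Section RewriteSound.
Variables (G : groupType) (x : nat -> G).
Hypothesis sq : forall i, (i < 3)%N -> x i * x i = 1.
Hypothesis x01 : (x 0%N * x 1%N) ^+ 3 = 1.
Hypothesis x12 : (x 1%N * x 2%N) ^+ 5 = 1.
Hypothesis x02 : (x 0%N * x 2%N) ^+ 2 = 1.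

Local Notation ev w := (\prod_(i <- w) x i).

Let xV i : (i < 3)%N -> (x i)^-1 = x i.
Proof. by move=> i3; apply: mulg1_eq; exact: sq. Qed.

Lemma ico_rules_sound l r : (l, r) \in ico_rules -> ev l = ev r.
Proof.
have xx i z : (i < 3)%N -> x i * (x i * z) = z.
  by move=> i3; rewrite mulgA sq // mul1g.
have braid02 z : x 0%N * (x 2%N * z) = x 2%N * (x 0%N * z).
  rewrite !mulgA; congr (_ * z).
  have /mulg1_eq : x 0%N * x 2%N * (x 0%N * x 2%N) = 1 by rewrite -expg2.
  by rewrite invgM !xV // => ->.
have braid01 z : x 0%N * (x 1%N * (x 0%N * z)) = x 1%N * (x 0%N * (x 1%N * z)).
  have /mulg1_eq e : x 0%N * x 1%N * x 0%N * (x 1%N * x 0%N * x 1%N) = 1.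
    by rewrite -[RHS]x01 !expgS expg0 mulg1 -!mulgA.
  by move: e; rewrite !invgM !xV // !mulgA => <-; rewrite -!mulgA.
have braid12 z : x 1%N * (x 2%N * (x 1%N * (x 2%N * (x 1%N * z)))) =
    x 2%N * (x 1%N * (x 2%N * (x 1%N * (x 2%N * z)))).
  have /mulg1_eq e : x 1%N * x 2%N * x 1%N * x 2%N * x 1%N *
      (x 2%N * x 1%N * x 2%N * x 1%N * x 2%N) = 1.
    by rewrite -[RHS]x12 !expgS expg0 mulg1 -!mulgA.
  by move: e; rewrite !invgM !xV // !mulgA => <-; rewrite -!mulgA.
have r7 z : x 0%N * (x 1%N * (x 2%N * (x 0%N * z))) =
    x 1%N * (x 0%N * (x 1%N * (x 2%N * z))).
  by rewrite -braid02 braid01.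
have r8 z : x 0%N * (x 1%N * (x 2%N * (x 1%N * (x 0%N * (x 1%N * z))))) =
    x 1%N * (x 0%N * (x 1%N * (x 2%N * (x 1%N * (x 0%N * z))))).
  by rewrite -braid01 r7.
have r9 z : x 0%N * (x 1%N * (x 2%N * (x 1%N * (x 2%N * (x 0%N * (x 1%N *
      (x 2%N * (x 1%N * (x 2%N * z))))))))) =
    x 1%N * (x 0%N * (x 1%N * (x 2%N * (x 1%N * (x 2%N * (x 0%N * (x 1%N *
      (x 2%N * (x 1%N * z))))))))).
  by rewrite -[x 2%N * (x 0%N * _)]braid02 -braid12 r8 -[x 2%N * (x 0%N * _)]braid02.
rewrite !inE => /orP[|/orP[|/orP[|/orP[|/orP[|/orP[|/orP[|/orP[]]]]]]]] /eqP[-> ->];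
  rewrite !big_cons !big_nil.
- by rewrite xx.
- by rewrite xx.
- by rewrite xx.
- exact: braid02.
- exact: braid01.
- exact: braid12.
- exact: r7.
- exact: r8.
- exact: r9.
Qed.

Lemma ico_reduce_sound w : ev (ico_reduce w) = ev w.
Proof.
have head_sound rs u : {subset rs <= ico_rules} -> ev (rewrite_head rs u) = ev u.
  elim: rs => //= -[l r] rs IH sub.
  case: prefixP => [[v ->]|_]; last first.
    by apply: IH => c cin; apply: sub; rewrite inE cin orbT.
  rewrite drop_size_cat // !big_cat /= (@ico_rules_sound l r) //.
  by apply: sub; rewrite inE eqxx.
have pass_sound u : ev (rewrite_pass u) = ev u.
  elim: u => // i u IH.
  rewrite -[rewrite_pass _]/(rewrite_head ico_rules (i :: rewrite_pass u)).
  rewrite head_sound //.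
  by rewrite !big_cons IH.
by rewrite /ico_reduce; elim: {1}16 => //= k IH; rewrite pass_sound.
Qed.

End RewriteSound.

Definition ico_letter (i : nat) : ico_group := ico_gen (inord i).

Local Notation ev w := (\prod_(i <- w) ico_letter i).

Lemma ico_letterE i j : (ico_letter i * ico_letter j) ^+
  string_matrix (p := [:: 3; 5]) (inord i) (inord j) = 1.
Proof. exact: coxeter_genE. Qed.

Lemma ico_letter_sq i : ico_letter i * ico_letter i = 1.
Proof. by have := ico_letterE i i; rewrite /string_matrix eqxx expg1. Qed.

Lemma ico_letterV i : (ico_letter i)^-1 = ico_letter i.
Proof. by apply: mulg1_eq; exact: ico_letter_sq. Qed.

Lemma ico_letter01 : (ico_letter 0 * ico_letter 1) ^+ 3 = 1.
Proof. by have := ico_letterE 0 1; rewrite /string_matrix -val_eqE /= !inordK. Qed.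

Lemma ico_letter12 : (ico_letter 1 * ico_letter 2) ^+ 5 = 1.
Proof. by have := ico_letterE 1 2; rewrite /string_matrix -val_eqE /= !inordK. Qed.

Lemma ico_letter02 : (ico_letter 0 * ico_letter 2) ^+ 2 = 1.
Proof. by have := ico_letterE 0 2; rewrite /string_matrix -val_eqE /= !inordK. Qed.

(** The 120 normal forms contain the empty word and are closed under
    multiplication by a generator. *)
Lemma ico_normal_form g : exists2 w, w \in ico_words & g = ev w.
Proof.
rewrite -(word_class_surj g) word_classE.
elim/last_ind: (repr g) => [|u l [w win e]].
  by exists [::] => //; rewrite word_eval_nil big_nil.
exists (ico_reduce (rcons w (l.1 : 'I_3))).
  have /allP/(_ _ win)/allP := ico_words_closed; apply.
  by case: l.1 => -[|[|[|]]].
rewrite ico_reduce_sound; first last.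
- exact: ico_letter02.
- exact: ico_letter12.
- exact: ico_letter01.
- by move=> i _; exact: ico_letter_sq.
rewrite -!cats1 word_eval_cat e big_cat big_seq1 /word_eval big_seq1.
congr (_ * _); rewrite -[presented_gen _]/ico_gen /ico_letter inord_val.
by case: (l.2); rewrite // -{1}[l.1]inord_val ico_letterV /ico_letter inord_val.
Qed.

Definition ico_pt (g : ico_group) : nat -> nat :=
  ico_act [seq val l.1 | l <- repr g].

Lemma ico_move_lt i v : (v < 12)%N -> (ico_move i v < 12)%N.
Proof.
have : all (fun i => all (fun v => ico_move i v < 12)%N (iota 0 12)) (iota 0 3).
  by vm_compute.
move/allP => tab v12; have [i3|i3] := ltnP i 3.
  have /allP/(_ v) : all (fun v => ico_move i v < 12)%N (iota 0 12).
    by apply: tab; rewrite mem_iota.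
  by rewrite mem_iota; apply.
rewrite /ico_move [X in nth _ X _]nth_default ?nth_nil //.
Qed.

Lemma ico_act_cat u w v : ico_act (u ++ w) v = ico_act w (ico_act u v).
Proof. by rewrite /ico_act foldl_cat. Qed.

Lemma ico_act_lt w v : (v < 12)%N -> (ico_act w v < 12)%N.
Proof. by elim: w v => //= i w IH v /(ico_move_lt i)/IH. Qed.

Lemma ico_act_relator (i j : 'I_3) v : (v < 12)%N ->
  ico_act [seq val l.1 | l <- coxeter_relator (string_matrix (p := [:: 3; 5])) i j] v
    = v.
Proof.
move=> v12; rewrite /coxeter_relator /string_matrix -val_eqE.
by case: i j => -[|[|[|//]]] /= ? [[|[|[|//]]] /= ?]; do 12?[case: v v12 => [//|v] v12].
Qed.

Lemma ico_act_equiv (u w : word 'I_3) v :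
  word_equiv (coxeter_relators (string_matrix (p := [:: 3; 5]))) u w -> (v < 12)%N ->
  ico_act [seq val l.1 | l <- u] v = ico_act [seq val l.1 | l <- w] v.
Proof.
move=> uw; elim: uw v => // {u w}.
- by move=> u w _ IH v v12; rewrite IH.
- by move=> u w z _ IH1 _ IH2 v v12; rewrite IH1 // IH2.
- move=> u u' w w' _ IH1 _ IH2 v v12; rewrite !map_cat !ico_act_cat IH1 // IH2 //.
  exact: ico_act_lt.
- move=> x b v v12; have := ico_act_relator x x v12.
  by rewrite /coxeter_relator /string_matrix eqxx.
- by move=> _ [i [j ->]] v; exact: ico_act_relator.
Qed.

Lemma ico_pt_class w v : (v < 12)%N ->
  ico_pt (word_class _ w) v = ico_act [seq val l.1 | l <- w] v.
Proof. by move=> v12; apply: ico_act_equiv => //; exact: word_repr. Qed.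

Lemma ico_pt_lt g v : (v < 12)%N -> (ico_pt g v < 12)%N.
Proof. exact: ico_act_lt. Qed.

Lemma ico_ptM g h v : (v < 12)%N -> ico_pt (g * h) v = ico_pt h (ico_pt g v).
Proof.
move=> v12; rewrite -{1}(word_class_surj g) -{1}(word_class_surj h).
by rewrite -word_class_cat ico_pt_class // map_cat ico_act_cat.
Qed.

Lemma ico_pt1 v : (v < 12)%N -> ico_pt 1 v = v.
Proof. by move=> v12; rewrite -[1]/(word_class _ [::]) ico_pt_class. Qed.

Lemma ico_pt_letter i v : (i < 3)%N -> (v < 12)%N ->
  ico_pt (ico_letter i) v = ico_move i v.
Proof.
move=> i3 v12; rewrite /ico_letter.
by rewrite -[ico_gen _]/(word_class _ [:: (inord i, false)]) ico_pt_class //= inordK.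
Qed.

Lemma ico_pt_ev w v : all (fun i => i < 3)%N w -> (v < 12)%N ->
  ico_pt (ev w) v = ico_act w v.
Proof.
elim: w v => [|i w IH] v /=; first by rewrite big_nil => _ /ico_pt1.
case/andP=> i3 w3 v12; rewrite big_cons ico_ptM // ico_pt_letter // IH //.
exact: ico_move_lt.
Qed.

Lemma ico_pt_word w v : w \in ico_words -> (v < 12)%N -> ico_pt (ev w) v = ico_act w v.
Proof. by move/(allP ico_words_letters); exact: ico_pt_ev. Qed.

(** The 120 normal forms act differently on the vertices. Together with
    ico_normal_form this reduces identities in the group [3,5] to computations
    with permutations. *)
Lemma ico_pt_inj g g' : (forall v, (v < 12)%N -> ico_pt g v = ico_pt g' v) -> g = g'.
Proof.
have [w win ->] := ico_normal_form g; have [w' win' ->] := ico_normal_form g'.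
move=> e; congr (ev _).
apply: (uniq_map_inj ico_words_faithful) => //.
apply/eq_in_map => v; rewrite mem_iota => v12.
by rewrite -!ico_pt_word // e.
Qed.

Definition ico_parabolic (j : nat) : set ico_group :=
  generated (ico_gen @` [set i | i != inord j]).

Lemma face_points_lt j v : v \in face_points j -> (v < 12)%N.
Proof.
have /allP : all (fun v => v < 12)%N (face_points j) by case: j => [|[|[|[|]]]].
exact.
Qed.

Definition stabilizes_face (j : nat) (g : ico_group) :=
  forall v, v \in face_points j -> ico_pt g v \in face_points j.

Lemma ico_parabolic_stable j g :
  (j < 3)%N -> ico_parabolic j g -> stabilizes_face j g.
Proof.
move=> j3 Pg; suff [] : stabilizes_face j g /\ stabilizes_face j g^-1 by [].
move: g Pg; apply: generated_min.
  split=> /= [|g h [Sg Sg'] [Sh Sh']|g [Sg Sg']]; last by rewrite invgK.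
    by rewrite invg1; split=> v vj; rewrite ico_pt1 ?(face_points_lt vj).
  rewrite invgM; split=> v vj; rewrite ico_ptM ?(face_points_lt vj) //.
    exact/Sh/Sg.
  exact/Sg'/Sh'.
move=> _ [i ij <-] /=; rewrite -(inord_val i) -/(ico_letter i) ico_letterV.
suff Si : stabilizes_face j (ico_letter i) by [].
move=> v vj; rewrite ico_pt_letter ?(face_points_lt vj) //.
have /allP/(_ j) := face_points_stable.
have -> : j \in [:: 0; 1; 2]%N by case: j j3 {ij vj} => [|[|[|]]].
move=> /(_ isT)/allP/(_ i).
have -> : nat_of_ord i \in [:: 0; 1; 2]%N by case: (i) => -[|[|[|]]].
move=> /(_ isT)/orP[/eqP ij'|/allP]; last exact.
by move: ij; rewrite /= -val_eqE /= ij' inordK ?eqxx.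
Qed.

Lemma ico_stabilizer (J : set nat) g : J `<=` [set j | (j < 3)%N] ->
  (forall j, J j -> stabilizes_face j g) ->
  generated (ico_gen @` [set i | ~ J (val i)]) g.
Proof.
move=> J3; have [w win ->] := ico_normal_form g => Jg.
have Jw j : J j -> j \notin w.
  move=> Jj; have j3 : (j < 3)%N := J3 _ Jj.
  have /allP/(_ _ win)/allP/(_ j) := ico_words_parabolic.
  have -> : j \in [:: 0; 1; 2]%N by case: (j) j3 => [|[|[|]]].
  move=> /(_ isT)/implyP; apply; apply/allP => v vj.
  by rewrite -ico_pt_word ?(face_points_lt vj) //; exact: Jg.
have [g1 gM _] := generated_subgroup (ico_gen @` [set i | ~ J (val i)]).
have w3 := allP ico_words_letters _ win.
elim: w w3 Jw {win Jg} => [_ _|i w IH /andP[i3 w3] Jw]; first by rewrite big_nil.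
rewrite big_cons; apply: gM.
  apply: sub_generated; exists (inord i) => //=; rewrite inordK // => /Jw.
  by rewrite inE eqxx.
by apply: IH => // j /Jw; rewrite inE negb_or => /andP[].
Qed.

Lemma ico_intersection (J : set nat) g : J `<=` [set j | (j < 3)%N] ->
  (forall j, J j -> ico_parabolic j g) ->
  generated (ico_gen @` [set i | ~ J (val i)]) g.
Proof.
move=> J3 Jg; apply: ico_stabilizer => // j Jj.
by apply: ico_parabolic_stable (Jg _ Jj); exact: J3.
Qed.

Local Notation F0 := (base_vertex ico_gen).

Lemma ico_parabolic0 : vertex_stabilizer ico_gen = ico_parabolic 0.
Proof.
by rewrite /ico_parabolic (_ : inord 0 = ord0) //; apply: val_inj; rewrite /= inordK.
Qed.

Lemma ico_stabE g : vertex_stabilizer ico_gen g <-> ico_pt g 0 = 0%N.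
Proof.
rewrite ico_parabolic0; split=> [/ico_parabolic_stable/(_ 0%N)|g0].
  by rewrite !inE eqxx => /(_ isT isT)/eqP.
have : generated (ico_gen @` [set i | ~ [set 0%N] (val i)]) g.
  by apply: ico_stabilizer => [_ -> //|_ -> v]; rewrite !inE => /eqP ->; rewrite g0.
apply: generated_mono => _ [i /= i0 <-]; exists i => //=.
by apply/eqP => i0'; apply: i0; rewrite i0' inordK.
Qed.

Lemma base_vactE g h : vact F0 g = vact F0 h <-> ico_pt g 0 = ico_pt h 0.
Proof.
have fix_iff : vact F0 g = vact F0 h <-> vertex_stabilizer ico_gen (g * h^-1).
  have [S1 SM SV] := generated_subgroup (ico_gen @` [set j | j != ord0]).
  rewrite -rcosetP; split=> [/(congr1 val) /= <-|gh].
    by exists 1; rewrite ?mul1g.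
  apply: val_inj => /=; have [a Sa <-] := gh; rewrite -rcosetM; congr (rcoset _ h).
  apply/seteqP; split=> [_ [b Sb <-]|b Sb]; first exact: SM.
  by exists (b * a^-1); rewrite ?mulgVK //; apply: SM => //; exact: SV.
rewrite fix_iff ico_stabE ico_ptM //; split=> [e|->]; last first.
  by rewrite -ico_ptM // mulgV ico_pt1.
by rewrite -[g](mulgVK h) ico_ptM // ico_ptM // e.
Qed.

Lemma vertexP (F : vertex ico_gen) : exists g, F = vact F0 g.
Proof.
case: F => F /[dup] /set_mem [g e] FP; exists g; apply: val_inj; exact: e.
Qed.

Lemma ico_pt_onto v : (v < 12)%N -> exists g, ico_pt g 0 = v.
Proof.
have : all (fun v => has (fun w => ico_act w 0 == v) vertex_words) (iota 0 12).
  by vm_compute.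
move=> /allP/(_ v) + v12; rewrite mem_iota v12 => /(_ isT)/hasP[w win /eqP <-].
exists (ev w); rewrite ico_pt_ev //.
have : all (all (fun i => i < 3)%N) vertex_words by vm_compute.
by move=> /allP; apply.
Qed.

Lemma ico_pt_alpha v : (v < 12)%N ->
  ico_pt ico_alpha v = ico_act (flatten (nseq 5 [:: 0; 1; 2]%N)) v.
Proof.
move=> v12; rewrite -ico_pt_ev //; congr (ico_pt _ v).
by rewrite /ico_alpha !expgS expg0 mulg1 !big_cons big_nil mulg1 -!mulgA.
Qed.

Lemma ico_pt_beta3 :
  ico_pt ((ico_letter 0 * ico_letter 1 * ico_letter 2) ^+ 3) 0 = 5.
Proof.
have := @ico_pt_ev (flatten (nseq 3 [:: 0; 1; 2]%N)) 0 isT isT.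
by rewrite !expgS expg0 mulg1 !big_cons big_nil mulg1 -!mulgA.
Qed.

(** The stabilizer of the base vertex has four orbits: the base vertex, its
    antipode, its five neighbours and their antipodes. The vertex that the third
    power of the Coxeter element reaches is of the last kind. This is why two
    additional relators suffice. *)
Lemma ico_stab_orbits g : exists d, vertex_stabilizer ico_gen d /\
  [\/ vact F0 g = F0, vact F0 g = vact F0 ico_alpha,
      vact F0 g = vact F0 (ico_letter 0 * d)
    | vact F0 g = vact F0 ((ico_letter 0 * ico_letter 1 * ico_letter 2) ^+ 3 * d)].
Proof.
have : all (fun v => has (fun w => [|| v == 0, v == 1, v == ico_act w 2
    | v == ico_act w 5]%N) base_stab_words) (iota 0 12) by vm_compute.
have g12 : (ico_pt g 0 < 12)%N by apply: ico_pt_lt.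
move=> /allP/(_ (ico_pt g 0)); rewrite mem_iota g12 => /(_ isT)/hasP[w win].
have w3 : all (fun i => i < 3)%N w.
  have : all (all (fun i => i < 3)%N) base_stab_words by vm_compute.
  by move=> /allP; apply.
have w0 : ico_act w 0 = 0%N.
  have : all (fun w => ico_act w 0 == 0%N) base_stab_words by vm_compute.
  by move=> /allP/(_ _ win)/eqP.
move=> cases; exists (ev w); split; first by apply/ico_stabE; rewrite ico_pt_ev.
case/or4P: cases => /eqP e; [apply: Or41|apply: Or42|apply: Or43|apply: Or44].
- by rewrite -[F0 in RHS]vact1; apply/base_vactE; rewrite ico_pt1.
- by apply/base_vactE; rewrite e ico_pt_alpha.
- by apply/base_vactE; rewrite e ico_ptM // ico_pt_letter // ico_pt_ev.
- by apply/base_vactE; rewrite e ico_ptM // ico_pt_beta3 ico_pt_ev.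
Qed.

Lemma ico_alpha_sq : ico_alpha * ico_alpha = 1.
Proof.
apply: ico_pt_inj => v v12; rewrite ico_ptM // ico_pt1 // (ico_pt_alpha v12).
rewrite ico_pt_alpha ?ico_act_lt //.
by do 12?[case: v v12 => [//|v] v12].
Qed.

Lemma ico_alpha_free (F : vertex ico_gen) : vact F ico_alpha <> F.
Proof.
have [g ->] := vertexP F; rewrite -vactM => /base_vactE.
rewrite -ico_alphaC ico_ptM // ico_pt_alpha // => e.
suff : ico_pt (g * g^-1) 1 = ico_pt (g * g^-1) 0 by rewrite mulgV !ico_pt1.
by rewrite !ico_ptM // -e.
Qed.

Lemma ico_letter_ord (i : 'I_3) : ico_gen i = ico_letter i.
Proof. by rewrite /ico_letter inord_val. Qed.

(** * The group generated by the vertex reflections *)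

Section CoxeterLift.
Variables (X : choiceType) (m : X -> X -> nat) (G : groupType) (f : X -> G).
Hypothesis fm : forall x y, (f x * f y) ^+ m x y = 1.

Definition coxeter_lift : coxeter_group m -> G := presented_lift f.

Let fR r : coxeter_relators m r -> word_eval f r = 1.
Proof. by move=> [x [y ->]]; rewrite word_eval_coxeter_relator. Qed.

Lemma coxeter_liftM : {morph coxeter_lift : x y / x * y}.
Proof. exact: presented_liftM fR. Qed.

Lemma coxeter_lift_gen x : coxeter_lift (coxeter_gen m x) = f x.
Proof. exact: presented_lift_gen fR x. Qed.

End CoxeterLift.

Lemma coxeter_generated (X : choiceType) (m : X -> X -> nat) w :
  generated (range (coxeter_gen m)) w.
Proof.
have [S1 SM SV] := generated_subgroup (range (coxeter_gen m)).
rewrite -(word_class_surj w) word_classE.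
elim: (repr w) => [|[x b] u IH]; first by rewrite word_eval_nil.
rewrite /word_eval big_cons; apply: SM => //=.
have Sx : generated (range (coxeter_gen m)) (coxeter_gen m x).
  by apply: sub_generated; exists x.
by case: b => //; exact: SV.
Qed.

(** The pair (b, k) stands for the element r^k y^b of the dihedral group of
    order 2 s, where y and z are generating reflections and r = y z; flip and
    flop are the right multiplications by y and by z. *)
Section DihedralPerm.
Variable s : nat.
Local Notation D := (bool * 'I_s)%type.

Definition flip (d : D) : D := (~~ d.1, d.2).
Definition flop (d : D) : D := (~~ d.1, if d.1 then ordS d.2 else ord_pred d.2).

Lemma flipK : involutive flip.
Proof. by case=> b k; rewrite /flip negbK. Qed.

Lemma flopK : involutive flop.
Proof. by case=> [[] k]; rewrite /flop /= ?ordSK ?ord_predK. Qed.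

Definition flip_perm : {perm D} := perm (inv_inj flipK).
Definition flop_perm : {perm D} := perm (inv_inj flopK).

Lemma flip_perm_sq : flip_perm * flip_perm = 1.
Proof. by apply/permP => d; rewrite permM !permE flipK. Qed.

Lemma flop_perm_sq : flop_perm * flop_perm = 1.
Proof. by apply/permP => d; rewrite permM !permE flopK. Qed.

Lemma iter_ordS k (i : 'I_s) : val (iter k (@ordS s) i) = ((i + k) %% s)%N.
Proof.
elim: k => [|k IH]; first by rewrite addn0 modn_small.
by rewrite iterS /= IH -addn1 modnDml addn1 addnS.
Qed.

Lemma flip_flop_iter k (i : 'I_s) :
  ((flip_perm * flop_perm) ^+ k) (false, i) = (false, iter k (@ordS s) i).
Proof.
elim: k => [|k IH]; first by rewrite expg0 perm1.
by rewrite expgSr permM IH permM !permE.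
Qed.

Lemma flip_flop_exp : (flip_perm * flop_perm) ^+ s = 1.
Proof.
have iterS_id (i : 'I_s) : iter s (@ordS s) i = i.
  by apply: val_inj; rewrite iter_ordS modnDr modn_small.
apply/permP => -[[] i]; rewrite perm1; last by rewrite flip_flop_iter iterS_id.
have -> k : ((flip_perm * flop_perm) ^+ k) (true, i) =
    (true, iter k (@ord_pred s) i).
  elim: k => [|k IH]; first by rewrite expg0 perm1.
  by rewrite expgSr permM IH permM !permE.
have can_iter k : cancel (iter k (@ord_pred s)) (iter k (@ordS s)).
  by elim: k => // k IH j; rewrite iterSr iterS ord_predK IH.
by rewrite -{2}(can_iter s i) iterS_id.
Qed.

End DihedralPerm.

Definition sign : Type := bool.
HB.instance Definition _ := Choice.on sign.
HB.instance Definition _ := isGroup.Build sign addbA addFb addbF addbb addbb.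

Lemma mul_swap_exp (G : groupType) (x y : G) n :
  (x * y) ^+ n = 1 -> (y * x) ^+ n = 1.
Proof.
have -> : y * x = (x * y) ^ x by rewrite conjgE !mulgA mulVg mul1g.
by move=> xy; rewrite -conjXg xy conj1g.
Qed.

Lemma expg_mod_eq1 (G : groupType) (x : G) p k :
  x ^+ p = 1 -> x ^+ (k %% p) = x ^+ k.
Proof.
by move=> xp; rewrite {2}(divn_eq k p) expgnDr mulnC expgnA xp expg1n mul1g.
Qed.

Lemma prod_mulr (G : groupType) (I : eqType) (r : seq I) (f g : I -> G) j z :
  uniq r -> j \in r -> g j = f j * z ->
  (forall i, i != j -> g i = f i /\ commute z (f i)) ->
  \prod_(i <- r) g i = (\prod_(i <- r) f i) * z.
Proof.
move=> ur jr gj gi; move: ur; case/splitPr: jr => r1 r2.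
rewrite cat_uniq /= negb_or => /and3P[_ /andP[jr1 _] /andP[jr2 _]].
have part r' : j \notin r' ->
    \prod_(i <- r') g i = \prod_(i <- r') f i /\ commute z (\prod_(i <- r') f i).
  move=> jr'; have nj i : i \in r' -> i != j by apply: contraTneq => ->.
  split; first by apply: eq_big_seq => i /nj/gi[].
  by rewrite big_seq; apply: commute_prod => i /nj/gi[].
rewrite !big_cat !big_cons /= gj; have [-> _] := part _ jr1; have [-> cz] := part _ jr2.
by rewrite -!mulgA cz.
Qed.

Section VertexGroup.
Variables (G : groupType) (n : nat) (tau : 'I_n.+1 -> G) (alpha : G) (s : nat).
Hypothesis alpha_sq : alpha * alpha = 1.
Hypothesis alpha_free : forall F : vertex tau, vact F alpha <> F.

Local Notation V := (vertex tau).
Local Notation W := (vertex_group tau alpha s).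
Local Notation sigma := (@sigma G n tau alpha s).

Lemma alphaK : involutive (fun F : V => vact F alpha).
Proof. by move=> F; rewrite -vactM alpha_sq vact1. Qed.

Lemma sigma_sq F : sigma F * sigma F = 1.
Proof.
by have := coxeter_genE (vertex_matrix alpha s) F F; rewrite /vertex_matrix eqxx expg1.
Qed.

Lemma sigmaV F : (sigma F)^-1 = sigma F.
Proof. by apply: mulg1_eq; exact: sigma_sq. Qed.

Lemma sigma_antipode F : (sigma F * sigma (vact F alpha)) ^+ s = 1.
Proof.
have := coxeter_genE (vertex_matrix alpha s) F (vact F alpha).
by rewrite /vertex_matrix eqxx; case: eqP => [/alpha_free|].
Qed.

Lemma sigma_prod_sq F F' : F' <> F -> F' <> vact F alpha ->
  (sigma F * sigma F') ^+ 2 = 1.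
Proof.
move=> /eqP nF /eqP nA; have := coxeter_genE (vertex_matrix alpha s) F F'.
by rewrite /vertex_matrix (negPf nF) (negPf nA).
Qed.

Lemma sigma_commute F F' : F' <> vact F alpha -> commute (sigma F) (sigma F').
Proof.
have [-> //|/eqP nF nA] := eqVneq F' F.
have := sigma_prod_sq nF nA; rewrite expg2 => /mulg1_eq.
by rewrite invgM !sigmaV.
Qed.

Lemma vertex_groupM_ind (P : W -> Prop) :
  P 1 -> (forall w F, P w -> P (w * sigma F)) -> forall w, P w.
Proof.
move=> P1 Ps w; have := coxeter_generated w.
pose S := [set x | forall u : W, P u <-> P (u * x)].
move=> wgen; suff /(_ 1) : S w by rewrite mul1g => -[+ _]; apply.
move: w wgen; apply: generated_min.
  split=> [u|x y Sx Sy u|x Sx u]; first by rewrite mulg1.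
    by rewrite mulgA -Sy -Sx.
  by rewrite (Sx (u * x^-1)) mulgVK.
move=> _ [F _ <-] u; split=> [|/(Ps _ F)]; first exact: Ps.
by rewrite -mulgA sigma_sq mulg1.
Qed.

Definition parity : W -> sign := coxeter_lift (fun=> true : sign).

Let parity_rel (F F' : V) :
  ((true : sign) * (true : sign)) ^+ vertex_matrix alpha s F F' = 1.
Proof. by rewrite -[_ * _]/(1 : sign) expg1n. Qed.

Lemma parityM : {morph parity : v w / v * w}.
Proof. exact: coxeter_liftM parity_rel. Qed.

Lemma parity_sigma F : parity (sigma F) = true.
Proof. exact: coxeter_lift_gen parity_rel F. Qed.

(** A pair of antipodal vertices generates a dihedral factor, onto which the
    whole group projects. *)
Section DihedralLift.
Variables (D : groupType) (y z : D) (F : V).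
Hypothesis yy : y * y = 1.
Hypothesis zz : z * z = 1.
Hypothesis yz : (y * z) ^+ s = 1.

Definition dihedral_gen (F' : V) : D :=
  if F' == F then y else if F' == vact F alpha then z else 1.

Let dihedral_sq F' : dihedral_gen F' * dihedral_gen F' = 1.
Proof. by rewrite /dihedral_gen; do 2?case: ifP => _; rewrite ?mulg1. Qed.

Let zy : (z * y) ^+ s = 1.
Proof. exact: mul_swap_exp. Qed.

Lemma dihedral_genE F1 F2 :
  (dihedral_gen F1 * dihedral_gen F2) ^+ vertex_matrix alpha s F1 F2 = 1.
Proof.
rewrite /vertex_matrix; case: eqP => [->|n21]; first by rewrite dihedral_sq expg1n.
case: eqP => [e2|n2a].
  rewrite e2 /dihedral_gen (inj_eq (can_inj alphaK)).
  have [->|n1] := eqVneq F1 F; first by case: eqP => // /alpha_free.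
  have [->|n1a] := eqVneq F1 (vact F alpha); first by rewrite alphaK eqxx.
  case: eqP => [e|_]; last by rewrite mulg1 expg1n.
  by case/negP: n1a; rewrite -e alphaK.
have : dihedral_gen F1 = 1 \/ dihedral_gen F2 = 1.
  rewrite /dihedral_gen.
  have [e1|n1] := eqVneq F1 F.
    right; rewrite -e1; do 2![case: eqP => // _].
  have [e1|n1a] := eqVneq F1 (vact F alpha); last by left.
  right; case: eqP => [e2|_]; first by case: n2a; rewrite e1 alphaK.
  by rewrite -e1; case: eqP.
by case=> ->; rewrite ?mul1g ?mulg1 expg2 dihedral_sq.
Qed.

Definition dihedral_lift : W -> D := coxeter_lift dihedral_gen.

Lemma dihedral_liftM : {morph dihedral_lift : v w / v * w}.
Proof. exact: coxeter_liftM dihedral_genE. Qed.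

Lemma dihedral_lift_sigma F' : dihedral_lift (sigma F') = dihedral_gen F'.
Proof. exact: coxeter_lift_gen dihedral_genE F'. Qed.

End DihedralLift.

Section Separation.
Hypothesis s_gt1 : (1 < s)%N.

Definition vertex_perm F : W -> {perm bool * 'I_s} :=
  dihedral_lift (flip_perm s) (flop_perm s) F.

Lemma vertex_permM F : {morph vertex_perm F : v w / v * w}.
Proof.
by apply: dihedral_liftM;
  [exact: flip_perm_sq|exact: flop_perm_sq|exact: flip_flop_exp].
Qed.

Lemma vertex_perm_sigma F F' :
  vertex_perm F (sigma F') = dihedral_gen (flip_perm s) (flop_perm s) F F'.
Proof.
by apply: dihedral_lift_sigma;
  [exact: flip_perm_sq|exact: flop_perm_sq|exact: flip_flop_exp].
Qed.

(** If F is not in T, the projection onto the dihedral factor of F maps the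
    generators from T to 1 or to the reflection other than that of F. *)
Lemma sigma_notin_generated (T : set V) F :
  generated (sigma @` T) (sigma F) -> T F.
Proof.
pose A := [set p : {perm bool * 'I_s} | p = 1 \/ p = flop_perm s].
have Agrp : is_subgroup A.
  split=> [|x y [->|->] [->|->]|x [->|->]]; rewrite /A /= ?mulg1 ?mul1g ?invg1
    ?flop_perm_sq; auto.
  by right; apply: mulg1_eq; exact: flop_perm_sq.
move=> gF; apply: contrapT => nTF.
have : A (vertex_perm F (sigma F)).
  move: gF; apply: (@generated_min _ (vertex_perm F @^-1` A)).
    by apply: preimage_subgroup => //; exact: vertex_permM.
  move=> _ [F' TF' <-] /=; rewrite vertex_perm_sigma /dihedral_gen.
  case: eqP => [e|_]; first by rewrite -e in nTF.
  by case: ifP => _; [right|left].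
rewrite vertex_perm_sigma /dihedral_gen eqxx.
pose d : bool * 'I_s := (false, Ordinal (ltnW s_gt1)).
case=> /(congr1 (fun p : {perm _} => p d)); rewrite ?perm1 !permE //.
move=> /(congr1 (fun c : bool * 'I_s => val c.2)) /=; rewrite add0n.
by case: (s) s_gt1 => [|[|s']] //= _; rewrite modn_small.
Qed.

End Separation.

(** The group is the direct product of its dihedral factors: with one vertex rep
    i from each antipodal pair, elements have unique coordinates. *)
Section Coordinates.
Variables (d : nat) (rep : 'I_d -> V).
Hypothesis rep_cover : forall F, exists i, F = rep i \/ F = vact (rep i) alpha.
Hypothesis rep_inj :
  forall i j, rep i = rep j \/ rep i = vact (rep j) alpha -> i = j.
Hypothesis s_gt0 : (0 < s)%N.

Local Notation coords := {ffun 'I_d -> bool * 'I_s}.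

Definition coordinates (w : W) : coords :=
  [ffun i => vertex_perm (rep i) w (false, Ordinal s_gt0)].

Definition dihedral_elt (i : 'I_d) (c : bool * 'I_s) : W :=
  (sigma (rep i) * sigma (vact (rep i) alpha)) ^+ c.2 *
  (if c.1 then sigma (rep i) else 1).

Definition of_coordinates (c : coords) : W := \prod_(i < d) dihedral_elt i (c i).

Lemma of_coordinatesK : cancel of_coordinates coordinates.
Proof.
move=> c; apply/ffunP => j; rewrite ffunE.
have pgen i : (vertex_perm (rep j) (sigma (rep i)) =
      if i == j then flip_perm s else 1) /\
    (vertex_perm (rep j) (sigma (vact (rep i) alpha)) =
      if i == j then flop_perm s else 1).
  rewrite !vertex_perm_sigma /dihedral_gen; have [->|/eqP ij] := eqVneq i j.
    by rewrite !eqxx; case: eqP => [/alpha_free|].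
  have nij F : F = rep i \/ F = vact (rep i) alpha ->
      F != rep j /\ F != vact (rep j) alpha.
    move=> Fi; split; apply/eqP => e; apply: ij; apply: rep_inj; move: Fi;
    rewrite e => -[e'|e']; auto.
    - by right; rewrite e' alphaK.
    - by left; apply: (can_inj alphaK).
  have [/negPf -> /negPf ->] := nij _ (or_introl erefl).
  by have [/negPf -> /negPf ->] := nij _ (or_intror erefl).
have pelt i : vertex_perm (rep j) (dihedral_elt i (c i)) =
    if i == j then (flip_perm s * flop_perm s) ^+ (c j).2 *
      (if (c j).1 then flip_perm s else 1) else 1.
  have M := @vertex_permM (rep j); have [p1 p2] := pgen i.
  rewrite /dihedral_elt M (morph_exp M) M p2 p1.
  rewrite (fun_if (vertex_perm (rep j))) p1 (morph_one M).
  by have [->|_] := eqVneq i j; rewrite // mulg1 expg1n mul1g if_same.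
rewrite /of_coordinates.
have -> : vertex_perm (rep j) (\prod_(i < d) dihedral_elt i (c i)) =
    \prod_(i < d) vertex_perm (rep j) (dihedral_elt i (c i)).
  have M := @vertex_permM (rep j).
  exact: (big_morph _ M (morph_one M)).
rewrite (eq_bigr _ (fun i _ => pelt i)) -big_mkcond big_pred1_eq permM.
rewrite flip_flop_iter; have -> : iter (c j).2 (@ordS s) (Ordinal s_gt0) = (c j).2.
  by apply: val_inj; rewrite iter_ordS add0n modn_small.
by case: (c j) => -[] k /=; rewrite ?permE // perm1.
Qed.

Lemma dihedral_elt_mul i c F : F = rep i \/ F = vact (rep i) alpha ->
  exists c', dihedral_elt i c * sigma F = dihedral_elt i c'.
Proof.
have r1 := sigma_antipode (rep i); have r2 := sigma_sq (rep i).
rewrite /dihedral_elt; set y := sigma (rep i); set z := sigma (vact (rep i) alpha).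
have expS (k : 'I_s) : (y * z) ^+ ordS k = (y * z) ^+ k * (y * z).
  by rewrite /= expg_mod_eq1 // expgSr.
have expP (k : 'I_s) : (y * z) ^+ ord_pred k * (y * z) = (y * z) ^+ k.
  by rewrite -expS ord_predK.
case: c => b k [->|->]; last first.
  exists (flop (b, k)); rewrite /flop -/z /=; case: b => /=.
    by rewrite -[((k.+1) %% s)%N]/(val (ordS k)) expS !mulg1 -mulgA.
  rewrite -[((k + s).-1 %% s)%N]/(val (ord_pred k)) mulg1.
  by rewrite -{1}expP -!mulgA sigma_sq mulg1.
exists (flip (b, k)) => /=; case: b; rewrite /= ?mulg1 // -mulgA -/y.
by rewrite /y r2 mulg1.
Qed.

(** Reflections at vertices that are not antipodal commute, so a generator
    multiplied from the right moves past the later factors into its own. *)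
Lemma of_coordinates_surj w : exists c, w = of_coordinates c.
Proof.
elim/vertex_groupM_ind: w => [|w F [c ->]].
  exists [ffun=> (false, Ordinal s_gt0)]; rewrite /of_coordinates big1 // => i _.
  by rewrite ffunE /dihedral_elt mulg1.
have [j Fj] := rep_cover F; have [c' cE] := dihedral_elt_mul (c j) Fj.
exists [ffun i => if i == j then c' else c i].
apply/esym/(@prod_mulr _ _ _ _ _ j); rewrite ?index_enum_uniq ?mem_index_enum //.
  by rewrite ffunE eqxx cE.
move=> i ij; rewrite ffunE (negPf ij); split=> //.
have ci F' : F' = rep i \/ F' = vact (rep i) alpha -> commute (sigma F) (sigma F').
  move=> Fi; apply: sigma_commute => e; case/eqP: ij; apply: rep_inj; move: Fi.
  rewrite e => -[<-|/(can_inj alphaK) <-]; last by case: Fj; auto.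
  by case: Fj => ->; rewrite ?alphaK; auto.
rewrite /dihedral_elt; apply: commuteM.
  by apply: commuteX; apply: commuteM; apply: ci; auto.
by case: (c i).1; [apply: ci; left|exact: commute1].
Qed.

Lemma coordinatesK : cancel coordinates of_coordinates.
Proof. by move=> w; have [c ->] := of_coordinates_surj w; rewrite of_coordinatesK. Qed.

Lemma parity_coordinates c :
  parity (of_coordinates c) = \big[addb/false]_(i < d) (c i).1.
Proof.
rewrite /of_coordinates (big_morph _ parityM (morph_one parityM)).
apply: eq_bigr => i _; rewrite /dihedral_elt parityM (morph_exp parityM) parityM.
rewrite !parity_sigma -[X in X ^+ _]/(1 : sign) expg1n mul1g.
by rewrite (fun_if parity) parity_sigma (morph_one parityM); case: (c i).1.
Qed.

End Coordinates.

End VertexGroup.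

(** * The parabolic subgroups of the halving group *)

Section Halving.
Variable s : nat.
Hypothesis s_gt1 : (1 < s)%N.

Local Notation V := (vertex ico_gen).
Local Notation TP := (two_power_group ico_gen ico_alphaC s).
Local Notation act := (vertex_action ico_gen ico_alphaC s).
Local Notation inl := (sdinl act).
Local Notation inr := (sdinr act).
Local Notation sg := (@sigma _ _ ico_gen ico_alpha s).
Local Notation S := (inr (sg F0)).
Local Notation rho := (ico2_gen s).
Local Notation fam := (halving_family rho).

Lemma actE F g : act (sg F) g = sg (vact F g).
Proof. exact: (vertex_group_act_sigma ico_alphaC). Qed.

Lemma S_sq : S * S = 1.
Proof. by rewrite -sdinrM sigma_sq. Qed.

Lemma conjS g : S * inl g * S = inl g * inr (sg (vact F0 g) * sg F0).
Proof. by rewrite sdinr_inl -mulgA -sdinrM actE. Qed.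

Lemma conjSM x y : S * (x * y) * S = (S * x * S) * (S * y * S).
Proof. by rewrite !mulgA -[_ * S * S]mulgA S_sq mulg1. Qed.

Lemma rho0 : rho ord0 = S.
Proof. by rewrite /ico2_gen /two_power_gen unlift_none. Qed.

Lemma rhoS (i : 'I_3) : rho (lift ord0 i) = inl (ico_gen i).
Proof. by rewrite /ico2_gen /two_power_gen liftK. Qed.

Lemma fam0 : fam ord0 = S * inl (ico_letter 0) * S.
Proof.
rewrite /halving_family eqxx rho0; congr (_ * _ * _).
have -> : inord 1 = lift ord0 (ord0 : 'I_3) by apply: val_inj; rewrite /= inordK.
by rewrite rhoS ico_letter_ord.
Qed.

Lemma famS (i : 'I_3) : fam (lift ord0 i) = inl (ico_letter i).
Proof. by rewrite /halving_family /= rhoS ico_letter_ord. Qed.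

Local Notation par := (@parity _ _ ico_gen ico_alpha s).

Lemma parity_act w g : par (act w g) = par w.
Proof.
have M := @parityM _ _ ico_gen ico_alpha s.
elim/vertex_groupM_ind: w => [|w F IH]; first by rewrite ract_one.
by rewrite ractM !M IH actE !parity_sigma.
Qed.

Definition tp_parity (x : TP) : sign := par x.2.

Lemma tp_parityM : {morph tp_parity : x y / x * y}.
Proof. by move=> x y; rewrite /tp_parity parityM parity_act. Qed.

Lemma fam_even i : tp_parity (fam i) = 1.
Proof.
have l1 g : tp_parity (inl g) = 1 by exact: (morph_one (@parityM _ _ _ _ _)).
have [->|[k ->]] : i = ord0 \/ exists k, i = lift ord0 k.
  by case: (unliftP ord0 i) => [k ->|->]; [right; exists k|left].
  by rewrite fam0 !tp_parityM l1 mulg1 /tp_parity parity_sigma.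
by rewrite famS l1.
Qed.

Definition face_vertices (k : nat) : set V := vact F0 @` ico_parabolic k.

(** The maximal parabolic subgroups of the halving group in coordinates. A coset
    of type 0 or 1 is a vertex of 2^(P,G(s)), that is an even or odd element of
    the group of vertex reflections; one of type 2 or 3 is a 2-face or a facet,
    that is an edge or triangle of the icosahedron together with a coset of the
    subgroup generated by its vertex reflections. *)
Definition halving_type (j : nat) : set TP :=
  match j with
  | 0 => [set x | x.2 = 1]
  | 1 => [set x | (S * x * S).2 = 1]
  | k.+1 => [set x | ico_parabolic k x.1 /\ generated (sg @` face_vertices k) x.2]
  end.

Lemma halving_type_subgroup j : is_subgroup (halving_type j).
Proof.
have T0 : is_subgroup [set x : TP | x.2 = 1].
  split=> [//|x y|x]; rewrite /mkset.
    by rewrite sd_mul2 => -> ->; rewrite ract_one mul1g.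
  by rewrite sd_inv2 => ->; rewrite invg1 ract_one.
have Mconj : {morph (fun x : TP => S * x * S) : x y / x * y} by exact: conjSM.
case: j => [|[|k]] //=; first exact: (preimage_subgroup Mconj T0).
have [P1 PM PV] := generated_subgroup (ico_gen @` [set i | i != inord k.+1]).
rewrite -/(ico_parabolic k.+1) in P1 PM PV.
have [S1 SM SV] := generated_subgroup (sg @` face_vertices k.+1).
have SJ g w : ico_parabolic k.+1 g -> generated (sg @` face_vertices k.+1) w ->
    generated (sg @` face_vertices k.+1) (act w g).
  move=> Pg; move: w.
  have M : {morph (act^~ g) : v w / v * w} by move=> v w; exact: ractM.
  apply: (@generated_min _ ((act^~ g) @^-1` generated (sg @` face_vertices k.+1))).
    by apply: preimage_subgroup => //; exact: generated_subgroup.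
  move=> _ [_ [a Pa <-] <-]; rewrite /preimage /mkset actE; apply: sub_generated.
  by exists (vact F0 (a * g)); [exists (a * g) => //; exact: PM|rewrite vactM].
split=> [//|x y [xg xw] [yg yw]|x [xg xw]]; rewrite /mkset.
  by rewrite sd_mul1 sd_mul2; split; [exact: PM|apply: SM => //; exact: SJ].
rewrite sd_inv1 sd_inv2; split; first exact: PV.
by apply: SJ; [exact: PV|exact: SV].
Qed.

Lemma face_vertices_base k a : ico_parabolic k a -> face_vertices k (vact F0 a).
Proof. by exists a. Qed.

Lemma sigma_inj : injective sg.
Proof.
move=> F F' e; apply/esym.
apply: (@sigma_notin_generated _ _ _ _ _ ico_alpha_sq ico_alpha_free s_gt1 [set F] F').
by apply: sub_generated; exists F.
Qed.

Lemma fix_base_stab g : vact F0 g = F0 <-> ico_parabolic 0 g.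
Proof.
by rewrite -ico_parabolic0 ico_stabE -{2}(vact1 F0) base_vactE ico_pt1.
Qed.

Local Notation parabolic J := (generated (fam @` ~` J)).

Lemma inl_parabolic (J : set 'I_4) k :
  generated (ico_gen @` [set i | ~ J (lift ord0 i)]) k -> parabolic J (inl k).
Proof.
move: k; apply: (@generated_min _ (inl @^-1` parabolic J)).
  apply: (preimage_subgroup (@sdinlM _ _ act)); exact: generated_subgroup.
move=> _ [i Ji <-]; apply: sub_generated; exists (lift ord0 i) => //.
by rewrite famS -ico_letter_ord.
Qed.

Lemma conj_parabolic (J : set 'I_4) k : ~ J ord0 ->
  generated (ico_gen @` [set i | i = ord0 \/ ~ J (lift ord0 i)]) k ->
  parabolic J (S * inl k * S).
Proof.
move=> J0; move: k.
apply: (@generated_min _ ((fun k => S * inl k * S) @^-1` parabolic J)).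
  apply: preimage_subgroup; last exact: generated_subgroup.
  by move=> g h; rewrite sdinlM conjSM.
move=> _ [i Ji <-]; rewrite /preimage /mkset.
have [->|i0] := eqVneq i ord0.
  by apply: sub_generated; exists ord0 => //; rewrite fam0 (ico_letter_ord ord0).
have -> : S * inl (ico_gen i) * S = inl (ico_gen i).
  have ti : vact F0 (ico_gen i) = F0.
    apply/fix_base_stab; rewrite -ico_parabolic0; apply: sub_generated.
    by exists i.
  by rewrite conjS ti sigma_sq (morph_one (@sdinrM _ _ act)) mulg1.
apply: sub_generated; exists (lift ord0 i); last by rewrite famS -ico_letter_ord.
by case: Ji i0 => [->|]; rewrite ?eqxx.
Qed.

(** For a fixed generator A of T, the elements w such that w or w * sigma A is a
    product of such pairs form a subgroup. *)
Lemma even_generated (T : set V) A w : T A -> generated (sg @` T) w -> par w = 1 ->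
  generated [set sg B * sg C | B in T & C in T] w.
Proof.
move=> TA gw.
pose E := generated [set sg B * sg C | B in T & C in T].
have [E1 EM EV] : is_subgroup E by exact: generated_subgroup.
have EBC B C : T B -> T C -> E (sg B * sg C).
  by move=> TB TC; apply: sub_generated; exists B => //; exists C.
have Epar v : E v -> par v = 1.
  have M := @parityM _ _ ico_gen ico_alpha s.
  apply: (@generated_min _ (par @^-1` [set 1])).
    apply: (preimage_subgroup M).
    by split=> [//|x y -> ->|x ->]; rewrite /mkset ?mulg1 ?invg1.
  by move=> _ [B _ [C _ <-]]; rewrite /preimage /mkset M !parity_sigma.
have EJ v : E v -> E (sg A * v * sg A).
  have MJ : {morph (fun v => sg A * v * sg A) : x y / x * y}.
    by move=> x y; rewrite !mulgA -[_ * sg A * sg A]mulgA sigma_sq mulg1.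
  apply: (@generated_min _ ((fun v => sg A * v * sg A) @^-1` E)).
    exact: (preimage_subgroup MJ (generated_subgroup _)).
  move=> _ [B TB [C TC <-]]; rewrite /preimage /mkset.
  have -> : sg A * (sg B * sg C) * sg A = (sg A * sg B) * (sg C * sg A).
    by rewrite !mulgA.
  by apply: EM; apply: EBC.
have AA x : x * sg A * sg A = x by rewrite -mulgA sigma_sq mulg1.
suff [//|EwA wE] : E w \/ E (w * sg A).
  by have := Epar _ EwA; rewrite parityM wE parity_sigma.
move: w gw; apply: (@generated_min _ [set v | E v \/ E (v * sg A)]); last first.
  by move=> _ [B TB <-]; right; exact: EBC.
split=> [|x y [Ex|Ex] [Ey|Ey]|x [Ex|Ex]]; rewrite /mkset.
- by left.
- by left; exact: EM.
- by right; rewrite -mulgA; exact: EM.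
- right; have -> : x * y * sg A = (x * sg A) * (sg A * y * sg A).
    by rewrite !mulgA AA.
  by apply: EM => //; exact: EJ.
- left; have -> : x * y = (x * sg A) * (sg A * (y * sg A) * sg A).
    by rewrite !mulgA !AA.
  by apply: EM => //; exact: EJ.
- by left; exact: EV.
- right; have -> : x^-1 * sg A = sg A * (x * sg A)^-1 * sg A.
    by rewrite invgM sigmaV !mulgA sigma_sq mul1g.
  by apply: EJ; exact: EV.
Qed.

Definition face_index (J : set 'I_4) : set nat :=
  [set k | exists2 j, J j & val j = k.+1].

Lemma val_lift0 n (i : 'I_n) : val (lift ord0 i) = i.+1 :> nat.
Proof. by []. Qed.

Lemma face_index_lt J : face_index J `<=` [set k | (k < 3)%N].
Proof. by move=> k [j _ jk]; have := ltn_ord j; rewrite -[nat_of_ord j]/(val j) jk. Qed.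

Lemma face_index_lift J (i : 'I_3) : J (lift ord0 i) -> face_index J (val i).
Proof. by exists (lift ord0 i). Qed.

Lemma halving_type0 g : halving_type 0 (inl g).
Proof. by []. Qed.

Lemma halving_type_inl k g : ico_parabolic k g -> halving_type k.+1 (inl g).
Proof.
case: k => [|k] Pg; last first.
  by split=> //; case: (generated_subgroup (sg @` face_vertices k.+1)).
by rewrite /halving_type /mkset conjS (proj2 (fix_base_stab g)) // sd_snd sigma_sq.
Qed.

Lemma halving_type_conj k g : ico_parabolic k.+1 g ->
  halving_type k.+2 (S * inl g * S).
Proof.
move=> Pg; rewrite conjS; split; rewrite ?sd_fst ?sd_snd //.
have [S1 SM SV] := generated_subgroup (sg @` face_vertices k.+1).
have [P1 _ _] := generated_subgroup (ico_gen @` [set i | i != inord k.+1]).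
apply: SM; apply: sub_generated; (eexists; last by []).
  exact: face_vertices_base.
by rewrite -(vact1 F0); exact: face_vertices_base.
Qed.

Lemma parabolic_split (J : set 'I_4) (x : TP) :
  parabolic J (inl x.1) -> parabolic J (inr x.2) -> parabolic J x.
Proof.
have [_ PM _] := generated_subgroup (fam @` ~` J).
by move=> P1 P2; rewrite (sd_split x); exact: PM.
Qed.

Lemma edge_stab_vertex g : ico_parabolic 1 g ->
  vact F0 g = F0 \/ vact F0 g = vact F0 (ico_letter 0).
Proof.
move=> /(ico_parabolic_stable (j := 1) isT)/(_ 0%N isT); rewrite !inE.
case/orP => /eqP e; [left|right].
  by rewrite -{2}(vact1 F0) base_vactE ico_pt1.
by rewrite base_vactE ico_pt_letter.
Qed.

(** The intersection condition. If J contains the type of a vertex of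
    2^(P,G(s)), the intersection lies in the stabilizer of that vertex, which is
    a copy of [3,5], and the intersection condition for [3,5] applies. Otherwise
    the reflections involved are those at the images of the base vertex under
    the icosahedral part of the intersection, and even products of them are
    products of elements of the two copies of [3,5]. *)
Lemma parabolic_cap (J : set 'I_4) (x : TP) : tp_parity x = 1 ->
  (forall j, J j -> halving_type j x) -> parabolic J x.
Proof.
move=> xeven Jx.
have Jx1 j k : J j -> val j = k.+2 -> ico_parabolic k.+1 x.1.
  by move=> /Jx + jk; rewrite jk => -[].
have mono (A B : set 'I_3) g : A `<=` B ->
    generated (ico_gen @` A) g -> generated (ico_gen @` B) g.
  by move=> AB; apply: generated_mono => _ [i Ai <-]; exists i => //; exact: AB.
(* the stabilizer of the even vertex is the icosahedral subgroup itself *)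
have [J0|nJ0] := pselect (J ord0).
  apply: parabolic_split; last first.
    rewrite (Jx _ J0) (morph_one (@sdinrM _ _ act)).
    by case: (generated_subgroup (fam @` ~` J)).
  apply: inl_parabolic; apply: (mono [set i | ~ face_index J (val i)]).
    by move=> i ni Ji; apply: ni; exact: face_index_lift.
  apply: ico_intersection; first exact: face_index_lt.
  move=> [|k] [j Jj jk]; last exact: Jx1 Jj jk.
  apply/fix_base_stab/sigma_inj; have := Jx _ Jj; rewrite jk /halving_type /mkset.
  rewrite (sd_split x) (Jx _ J0) (morph_one (@sdinrM _ _ act)) mulg1.
  rewrite conjS sd_snd => e.
  by rewrite -[sg F0]mul1g -e -mulgA sigma_sq mulg1.
(* the stabilizer of the odd vertex is its conjugate by S *)
have [J1|nJ1] := pselect (J (lift ord0 (ord0 : 'I_3))).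
  have -> : x = S * inl x.1 * S.
    have := Jx _ J1; rewrite /halving_type /= => x1.
    have : S * x * S = inl x.1.
      by apply: sd_ext; rewrite ?x1 // !sd_mul1 /= mul1g mulg1.
    by move=> <-; rewrite !mulgA S_sq mul1g -mulgA S_sq mulg1.
  apply: conj_parabolic => //.
  apply: (mono [set i | ~ [set k | 0 < k /\ face_index J k]%N (val i)]).
    move=> i /= ni; have [->|i0] := eqVneq i ord0; [by left|right=> Ji].
    by apply: ni; split; [rewrite lt0n|exact: face_index_lift].
  apply: ico_intersection => [k [_ /face_index_lt]//|].
  by move=> [|k] [// _ [j Jj jk]]; exact: Jx1 Jj jk.
have J1 j : J j -> exists k, val j = k.+2.
  case: j => -[|[|k]] jlt Jj; last by exists k.
    by case: nJ0; congr (J _): Jj; apply: val_inj.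
  by case: nJ1; congr (J _): Jj; apply: val_inj.
have x1G : generated (ico_gen @` [set i | ~ J (lift ord0 i)]) x.1.
  apply: (mono [set i | ~ face_index J (val i)]).
    by move=> i ni Ji; apply: ni; exact: face_index_lift.
  apply: ico_intersection; first exact: face_index_lt.
  move=> k [j Jj jk]; have [k' jk'] := J1 _ Jj.
  by have := Jx1 _ _ Jj jk'; move: jk; rewrite jk' => -[->].
apply: parabolic_split; first exact: inl_parabolic.
pose GJ := generated (ico_gen @` [set i | ~ J (lift ord0 i)]).
have [G1 GM GV] : is_subgroup GJ by exact: generated_subgroup.
have [P1 PM PV] := generated_subgroup (fam @` ~` J).
have w_gen : generated (sg @` (vact F0 @` GJ)) x.2.
  have up A : A `<=` vact F0 @` GJ ->
      generated (sg @` A) x.2 -> generated (sg @` (vact F0 @` GJ)) x.2.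
    by move=> AT; apply: generated_mono => _ [B AB <-]; exists B => //; exact: AT.
  have tau0 : GJ (ico_letter 0).
    by rewrite -(ico_letter_ord ord0); apply: sub_generated; exists ord0.
  have [[j Jj j2]|nJ2] := pselect (exists2 j, J j & val j = 2).
    apply: (up (face_vertices 1)); last by have := Jx _ Jj; rewrite j2 => -[].
    move=> _ [g /edge_stab_vertex[->|->] <-]; last by exists (ico_letter 0).
    by exists 1 => //; exact: vact1.
  have [[j Jj j3]|nJ3] := pselect (exists2 j, J j & val j = 3).
    apply: (up (face_vertices 2)); last by have := Jx _ Jj; rewrite j3 => -[].
    move=> _ [g Pg <-]; exists g => //; move: Pg; apply: mono => i /= i2 Ji.
    have [k] := J1 _ Ji; rewrite val_lift0 => -[ik].
    have k1 : k = 1%N.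
      have := ltn_ord i; rewrite ik; case: (k) ik => [|[|//]] ik _ //.
      by case: nJ2; exists (lift ord0 i); rewrite ?val_lift0 ?ik.
    by move/eqP: i2; apply; apply: val_inj; rewrite /= ik k1 inordK.
  have allG g : GJ g.
    have := coxeter_generated g; apply: mono => i _ /= Ji.
    have [k] := J1 _ Ji; rewrite val_lift0 => -[ik].
    have := ltn_ord i; rewrite ik; case: (k) ik => [|[|//]] ik _.
      by case: nJ2; exists (lift ord0 i); rewrite ?val_lift0 ?ik.
    by case: nJ3; exists (lift ord0 i); rewrite ?val_lift0 ?ik.
  have := coxeter_generated x.2; apply: generated_mono => _ [F _ <-].
  by have [g ->] := vertexP F; exists (vact F0 g) => //; exists g.
have T0 : (vact F0 @` GJ) F0 by exists 1 => //; exact: vact1.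
(* a product of two reflections is a product of elements of both copies *)
have := even_generated T0 w_gen xeven; move: {w_gen xeven} x.2.
apply: (@generated_min _ (inr @^-1` parabolic J)).
  exact: (preimage_subgroup (@sdinrM _ _ act) (generated_subgroup _)).
move=> _ [_ [k Gk <-] [_ [l Gl <-] <-]]; rewrite /preimage /mkset.
have -> : inr (sg (vact F0 k) * sg (vact F0 l)) =
    inl k^-1 * (S * inl (k * l^-1) * S) * inl l.
  rewrite conjS mulgA -sdinlM -mulgA sdinr_inl ractM !actE -vactM mulgVK.
  by rewrite mulgA -sdinlM -mulgA mulgVK mulVg (morph_one (@sdinlM _ _ act)) mul1g.
apply: (PM); last by apply: inl_parabolic.
apply: PM; first by apply: inl_parabolic; exact: GV.
apply: conj_parabolic => //.
have : GJ (k * l^-1) by apply: GM => //; exact: GV.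
by apply: mono => i; right.
Qed.

Local Notation H := (halving_group rho).
Local Notation h := (halving_gen rho).
Local Notation K := (halving_parabolic rho).

Lemma val_even (x : H) : tp_parity (val x) = 1.
Proof.
have /set_mem := valP x; apply: (@generated_min _ (tp_parity @^-1` [set 1])).
  apply: (preimage_subgroup tp_parityM).
  by split=> [//|u v -> ->|u ->]; rewrite /mkset ?mulg1 ?invg1.
by move=> _ [i _ <-]; exact: fam_even.
Qed.

Lemma even_val (y : TP) : tp_parity y = 1 -> exists x : H, val x = y.
Proof.
move=> yeven; apply: gen_groupP; have := @parabolic_cap set0 y yeven.
by move=> /(_ (fun _ => False_ind _)); apply: generated_mono => _ [i _ <-]; exists i.
Qed.

Lemma halving_cap (J : set 'I_4) (x : H) :
  (forall j, J j -> halving_type j (val x)) -> generated (h @` ~` J) x.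
Proof.
move=> Jx; apply/gen_group_generated; apply: parabolic_cap => //.
exact: (val_even x).
Qed.

Lemma ord_cases n (P : 'I_n.+1 -> Prop) :
  P ord0 -> (forall i, P (lift ord0 i)) -> forall i, P i.
Proof. by move=> P0 PS i; case: (unliftP ord0 i) => [k|] ->. Qed.

Lemma letter_parabolic (i : 'I_3) k :
  (k < 3)%N -> val i != k -> ico_parabolic k (ico_letter i).
Proof.
move=> k3 ik; rewrite -ico_letter_ord; apply: sub_generated; exists i => //=.
by apply: contra_neq ik => ->; rewrite /= inordK.
Qed.

Lemma fam_type (i j : 'I_4) : i <> j -> halving_type j (fam i).
Proof.
elim/ord_cases: i => [|i].
  rewrite fam0; elim/ord_cases: j => // j _; rewrite val_lift0.
  case: j => -[|k] k3; last first.
    by apply: halving_type_conj; apply: (@letter_parabolic ord0).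
  rewrite -[halving_type _ _]/((S * (S * inl (ico_letter 0) * S) * S).2 = 1).
  by rewrite !mulgA S_sq mul1g -mulgA S_sq mulg1.
rewrite famS; elim/ord_cases: j => [_|j ij]; first exact: halving_type0.
rewrite val_lift0; apply: halving_type_inl; apply: letter_parabolic => //.
by apply: contra_not_neq ij => /val_inj ->.
Qed.

Lemma halving_parabolicE (j : 'I_4) (x : H) : K j x <-> halving_type j (val x).
Proof.
split=> [|xj].
  move: x; apply: (@generated_min _ (val @^-1` halving_type j)).
    by apply: preimage_subgroup => //; exact: halving_type_subgroup.
  by move=> _ [i /eqP ij <-]; exact: fam_type.
have := @halving_cap [set j] x; have -> : ~` [set j] = [set i | i != j].
  by apply/seteqP; split=> i /eqP.
by apply=> _ ->.
Qed.

Lemma halving_gen_sq i : h i * h i = 1.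
Proof.
apply: val_inj => /=; elim/ord_cases: i => [|i].
  rewrite fam0 -conjSM -sdinlM ico_letter_sq (morph_one (@sdinlM _ _ act)).
  by rewrite mulg1 S_sq.
by rewrite famS -sdinlM ico_letter_sq (morph_one (@sdinlM _ _ act)).
Qed.

Lemma ico_letter_neq1 (i : 'I_3) : ico_letter i <> 1.
Proof.
move=> /(congr1 (fun g => [seq ico_pt g v | v <- iota 0 12])).
have pt g g' : {in iota 0 12, ico_pt g =1 g'} ->
    [seq ico_pt g v | v <- iota 0 12] = [seq g' v | v <- iota 0 12].
  by move=> gg; apply/eq_in_map.
rewrite (pt _ (ico_move i)); last first.
  by move=> v; rewrite mem_iota => v12; exact: ico_pt_letter.
rewrite (pt 1 id); last by move=> v; rewrite mem_iota => v12; exact: ico_pt1.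
by case: i => -[|[|[|//]]].
Qed.

Lemma halving_gen_neq1 i : h i <> 1.
Proof.
have inl_inj : injective inl by move=> g g' /(congr1 fst).
have i1 : inl 1 = 1 by exact: (morph_one (@sdinlM _ _ act)).
move=> /(congr1 val); elim/ord_cases: i => [|i] /=; last first.
  by rewrite famS -i1 => /inl_inj/ico_letter_neq1.
rewrite fam0 => e; apply: (@ico_letter_neq1 ord0); apply: inl_inj.
have : S * (S * inl (ico_letter 0) * S) * S = S * 1 * S by rewrite e.
by rewrite mulg1 S_sq -i1 !mulgA S_sq mul1g -mulgA S_sq mulg1.
Qed.

(** A 2-face or facet that meets both the base vertex and the vertex adjacent to
    it contains the edge between them, because its reflections then generate the
    one at the base vertex. *)
Lemma move_base_vertex k (u v : TP) : u.2 = 1 -> (S * v * S).2 = 1 ->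
  halving_type k.+2 (v * u^-1) ->
  exists2 m, ico_parabolic k.+1 m & vact F0 (m * u.1) = F0.
Proof.
move=> u2 v2 [vu1 vu2].
have vE : v = S * inl v.1 * S.
  have -> : inl v.1 = S * v * S.
    by apply: sd_ext; rewrite ?v2 // !sd_mul1 /= mul1g mulg1.
  by rewrite !mulgA S_sq mul1g -mulgA S_sq mulg1.
have [S1 SM SV] := generated_subgroup (sg @` face_vertices k.+1).
move: vu2 vu1; rewrite vE conjS sd_mul1 sd_mul2 sd_inv1 sd_inv2 sd_fst sd_snd u2.
rewrite invg1 ract_one mulg1 ractM !actE -vactM => g12 g1.
have gF : generated (sg @` face_vertices k.+1) (sg (vact F0 (u.1)^-1)).
  have gA : generated (sg @` face_vertices k.+1) (sg (vact F0 (v.1 * (u.1)^-1))).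
    apply: sub_generated; exists (vact F0 (v.1 * (u.1)^-1)) => //.
    exact: face_vertices_base.
  have := SM _ _ (SV _ gA) g12; rewrite mulgA mulVg mul1g; exact.
have [m Pm mE] := sigma_notin_generated ico_alpha_sq ico_alpha_free s_gt1 gF.
by exists m => //; rewrite vactM mE -vactM mulVg vact1.
Qed.

Lemma type0E (y : TP) : halving_type 0 y -> y = inl y.1.
Proof. by move=> y2; apply: sd_ext. Qed.

Lemma type1E (y : TP) : halving_type 1 y -> y = S * inl y.1 * S.
Proof.
move=> y2; have -> : inl y.1 = S * y * S.
  by apply: sd_ext; rewrite ?y2 // !sd_mul1 /= mul1g mulg1.
by rewrite !mulgA S_sq mul1g -mulgA S_sq mulg1.
Qed.

Lemma inlF g g' : inl g * (inl g')^-1 = inl (g * g'^-1).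
Proof. by rewrite -(morph_inv (@sdinlM _ _ act)) sdinlM. Qed.

Lemma conjF g g' : (S * inl g * S) * (S * inl g' * S)^-1 = S * inl (g * g'^-1) * S.
Proof.
by rewrite -(morph_inv conjSM) -conjSM -(morph_inv (@sdinlM _ _ act)) -sdinlM.
Qed.

(** The reflection that reverses the base edge fixes the base triangle. *)
Lemma edge_stab_fix m : ico_parabolic 1 m ->
  exists c, [/\ vact F0 c = F0, ico_parabolic 1 c & ico_parabolic 2 (c * m^-1)].
Proof.
move=> m1.
have t1 : ico_parabolic 1 (ico_letter 0) by exact: (@letter_parabolic ord0).
have t2 : ico_parabolic 2 (ico_letter 0) by exact: (@letter_parabolic ord0).
have [m0|m0] := edge_stab_vertex m1.
  exists m; rewrite mulgV; split=> //.
  by case: (generated_subgroup (ico_gen @` [set i | i != inord 2])).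
have [_ M1 _] := generated_subgroup (ico_gen @` [set i | i != inord 1]).
exists (ico_letter 0 * m); rewrite mulgK; split=> //; last exact: M1.
have [//|e] := edge_stab_vertex (M1 _ _ t1 m1).
have : vact F0 (ico_letter 0 * m) = vact F0 m by rewrite e m0.
rewrite vactM => /vact_inj/fix_base_stab; rewrite -ico_parabolic0 ico_stabE.
by rewrite ico_pt_letter.
Qed.

(** Let the element to be added be a 2-face or facet. If it meets two elements
    of smaller type, the common element is sought in the stabilizer of a vertex
    of 2^(P,G(s)) among them, where only conditions on the icosahedral part
    remain. For a 2-face among them the part v.1 of one of its elements serves,
    corrected by edge_stab_fix when the vertex has type 0; two vertices alone
    are handled by move_base_vertex. *)
Lemma tp_meet (l : nat) (J : set nat) (x : TP) : (l <= 3)%N -> tp_parity x = 1 ->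
  (forall j, J j -> (j < l)%N) ->
  (forall j, J j -> exists u : TP,
     [/\ tp_parity u = 1, halving_type j u & halving_type l (u * x^-1)]) ->
  exists z : TP, [/\ tp_parity z = 1, halving_type l (z * x^-1)
     & forall j, J j -> halving_type j z].
Proof.
move=> l3 xeven Jl Jx; have [T1 TM TV] := halving_type_subgroup l.
have [P1 PM _] := generated_subgroup (ico_gen @` [set i | i != inord 2]).
have inl_even g : tp_parity (inl g) = 1 by exact: (morph_one (@parityM _ _ _ _ _)).
have conj_even g : tp_parity (S * inl g * S) = 1.
  by rewrite !tp_parityM inl_even mulg1 /tp_parity parity_sigma.
have base u z : tp_parity z = 1 -> halving_type l (u * x^-1) ->
    halving_type l (z * u^-1) -> (forall j, J j -> halving_type j z) ->
    exists z : TP, [/\ tp_parity z = 1, halving_type l (z * x^-1)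
     & forall j, J j -> halving_type j z].
  move=> zeven ux zu zJ; exists z; split=> //.
  by have := TM _ _ zu ux; rewrite mulgA mulgVK.
have single u j : tp_parity u = 1 -> halving_type j u -> halving_type l (u * x^-1) ->
    (forall i, J i -> i = j) ->
    exists z : TP, [/\ tp_parity z = 1, halving_type l (z * x^-1)
     & forall j, J j -> halving_type j z].
  by move=> ueven uj ux Jj; apply: (base u u) => // [|i /Jj ->//]; rewrite mulgV.
have J012 j : J j -> [\/ j = 0%N, j = 1%N | j = 2].
  move=> Jj; have := leq_trans (Jl _ Jj) l3; case: j {Jj} => [|[|[|]]] // _;
  by [apply: Or31|apply: Or32|apply: Or33].
have l_eq3 : J 2 -> l = 3 by move=> /Jl l2; apply/eqP; rewrite eqn_leq l3.
have [J0|J0] := pselect (J 0%N).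
  have [u [ueven /type0E uE ux]] := Jx _ J0.
  have [J2|J2] := pselect (J 2).
    have [v [veven [v1 _] vx]] := Jx _ J2.
    have vu : halving_type l (v * u^-1).
      by have := TM _ _ vx (TV _ ux); rewrite invgM invgK mulgA mulgVK.
    have [c [cF c1 c2]] := edge_stab_fix v1.
    apply: (base u (inl c)) => // [|j /J012[]->].
    - move: vu; rewrite (l_eq3 J2) uE inlF => -[vu1 _].
      apply: halving_type_inl; rewrite -(mulgVK v.1 c) -mulgA.
      by apply: PM => //; move: vu1; rewrite uE sd_mul1 sd_inv1.
    - exact: halving_type0.
    - by apply: halving_type_inl; apply/fix_base_stab.
    - exact: halving_type_inl.
  have [J1|J1] := pselect (J 1%N); last first.
    by apply: (single u 0%N) => //; [rewrite uE|move=> j /[dup]/J012[]->].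
  have [v [veven v1 vx]] := Jx _ J1.
  have [k lk] : exists k, l = k.+2.
    by exists l.-2; case: (l) (Jl _ J1) => [|[|k]].
  have vu : halving_type l (v * u^-1).
    by have := TM _ _ vx (TV _ ux); rewrite invgM invgK mulgA mulgVK.
  have [m mk mF] : exists2 m, ico_parabolic k.+1 m & vact F0 (m * u.1) = F0.
    by apply: (@move_base_vertex k u v); [rewrite uE|exact: v1|rewrite -lk].
  apply: (base u (inl (m * u.1))) => // [|j /[dup] Jj /J012[]e].
  - by rewrite {2}uE inlF mulgK lk; exact: halving_type_inl.
  - by rewrite e.
  - by rewrite e; apply: halving_type_inl; apply/fix_base_stab.
  - by rewrite e in Jj.
have [J1|J1] := pselect (J 1%N).
  have [u [ueven /type1E uE ux]] := Jx _ J1.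
  have [J2|J2] := pselect (J 2); last first.
    apply: (single u 1%N) => //; last by move=> j /[dup]/J012[]->.
    by rewrite uE /halving_type /mkset !mulgA S_sq mul1g -mulgA S_sq mulg1.
  have [v [veven [v1 _] vx]] := Jx _ J2.
  have vu : halving_type l (v * u^-1).
    by have := TM _ _ vx (TV _ ux); rewrite invgM invgK mulgA mulgVK.
  apply: (base u (S * inl v.1 * S)) => // [|j /[dup] Jj /J012[]e].
  - move: vu; rewrite (l_eq3 J2) => -[vu1 _].
    rewrite {1}uE conjF; apply: halving_type_conj.
    by move: vu1; rewrite sd_mul1 sd_inv1.
  - by rewrite e in Jj.
  - by rewrite e /halving_type /mkset !mulgA S_sq mul1g -mulgA S_sq mulg1.
  - by rewrite e; exact: halving_type_conj.
have [J2|J2] := pselect (J 2).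
  have [u [ueven u2 ux]] := Jx _ J2.
  by apply: (single u 2) => // j /[dup]/J012[]->.
exists x; split=> //; first by rewrite mulgV.
by move=> j /[dup]/J012[]->.
Qed.

Lemma halving_meet (l : 'I_4) (J : set 'I_4) (x : H) :
  (forall j, J j -> (j < l)%N) ->
  (forall j, J j -> exists u, K j u /\ K l (u * x^-1)) ->
  exists z, K l (z * x^-1) /\ forall j, J j -> K j z.
Proof.
move=> Jl Jx.
have [z [zeven zx zJ]] : exists z : TP, [/\ tp_parity z = 1,
    halving_type l (z * (val x)^-1)
    & forall j, [set val j | j in J] j -> halving_type j z].
  apply: tp_meet => [|||_ [j Jj <-]].
  - by rewrite -ltnS.
  - exact: val_even.
  - by move=> _ [j /Jl + <-].
  have [u [uj ux]] := Jx _ Jj; exists (val u); split; first exact: val_even.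
    exact/halving_parabolicE.
  exact/(halving_parabolicE l (u * x^-1)).
have [z' z'E] := even_val zeven; exists z'; split.
  by apply/halving_parabolicE; rewrite -z'E in zx; exact: zx.
by move=> j Jj; apply/halving_parabolicE; rewrite z'E; apply: zJ; exists j.
Qed.

Theorem halving_regular_hypertope : regular_hypertope (halving_system rho).
Proof.
apply: (@coset_regular_hypertope _ _ _ h).
- by move=> i j /eqP ij; apply: sub_generated; exists i.
- exact: halving_gen_sq.
- exact: halving_gen_neq1.
- by move=> J x Jx; apply: halving_cap => j /Jx/halving_parabolicE.
- by move=> F; apply: flag_common_ordinal; exact: halving_meet.
Qed.

Theorem halving_automorphism_group :
  exists phi : {multiplicative H -> taut (halving_system rho)}, bijective phi /\
    forall g A, itype (phi g A) = itype A /\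
      celt_set (phi g A) = rcoset (celt_set A) g.
Proof.
apply: (@coset_automorphism_group _ _ _ h).
- by move=> i j /eqP ij; apply: sub_generated; exists i.
- exact: halving_gen_sq.
- exact: halving_gen_neq1.
- by move=> J x Jx; apply: halving_cap => j /Jx/halving_parabolicE.
- by move=> F; apply: flag_common_ordinal; exact: halving_meet.
Qed.

End Halving.

(** * The order of the halving group *)

Definition ico_elt (k : 'I_120) : ico_group :=
  \prod_(i <- nth [::] ico_words k) ico_letter i.

Lemma ico_elt_inj : injective ico_elt.
Proof.
move=> k l e; have size_words : size ico_words = 120 by [].
have win (i : 'I_120) : nth [::] ico_words i \in ico_words.
  by rewrite mem_nth // size_words.
have u : uniq ico_words by apply: map_uniq ico_words_faithful.
apply/val_inj/eqP; rewrite -(nth_uniq [::] _ _ u) ?size_words //=; apply/eqP.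
apply: (uniq_map_inj ico_words_faithful) => //.
apply/eq_in_map => v; rewrite mem_iota => v12.
by rewrite -!ico_pt_word // -/(ico_elt k) e.
Qed.

Lemma ico_elt_surj g : exists k, g = ico_elt k.
Proof.
have [w win ->] := ico_normal_form g.
have k120 : (index w ico_words < 120)%N by rewrite -[120]/(size ico_words) index_mem.
by exists (Ordinal k120); rewrite /ico_elt nth_index.
Qed.

Lemma ico_pt_antipode v : (v < 12)%N ->
  ico_pt ico_alpha v = if odd v then v.-1 else v.+1.
Proof.
move=> v12; rewrite ico_pt_alpha //.
by do 12?[case: v v12 => [//|v] v12].
Qed.

Lemma diag_lt (i : 'I_6) : (i.*2 < 12)%N.
Proof. by rewrite -[12]/(6.*2) ltn_double. Qed.

(** A choice of one vertex from each antipodal pair. *)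
Definition diagonal (i : 'I_6) : vertex ico_gen :=
  vact F0 (sval (cid (ico_pt_onto (diag_lt i)))).

Lemma diagonalE (i : 'I_6) : exists2 g, diagonal i = vact F0 g & ico_pt g 0 = i.*2.
Proof. by exists (sval (cid (ico_pt_onto (diag_lt i)))) => //; case: cid. Qed.

Lemma diagonal_cover F :
  exists i, F = diagonal i \/ F = vact (diagonal i) ico_alpha.
Proof.
have [g ->] := vertexP F; have g12 : (ico_pt g 0 < 12)%N by exact: ico_pt_lt.
have i6 : ((ico_pt g 0)./2 < 6)%N by rewrite ltn_half_double.
exists (Ordinal i6); have [h -> hE] := diagonalE (Ordinal i6).
rewrite -vactM !base_vactE ico_ptM // hE /= ico_pt_antipode ?odd_double.
  have := odd_double_half (ico_pt g 0).
  by case: odd => /= e; [right|left]; rewrite -[LHS]e.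
by rewrite -[12]/(6.*2) ltn_double.
Qed.

Lemma diagonal_inj i j :
  diagonal i = diagonal j \/ diagonal i = vact (diagonal j) ico_alpha -> i = j.
Proof.
have [g -> gE] := diagonalE i; have [h -> hE] := diagonalE j.
rewrite -vactM !base_vactE ico_ptM // hE gE ico_pt_antipode ?diag_lt // odd_double.
case=> [/double_inj/val_inj//|e].
by have := congr1 odd e; rewrite /= !odd_double.
Qed.

Section Order.
Variable s : nat.
Hypothesis s_gt1 : (1 < s)%N.
Let s_gt0 : (0 < s)%N := ltnW s_gt1.

Local Notation coords := {ffun 'I_6 -> bool * 'I_s}.
Local Notation W := (vertex_group ico_gen ico_alpha s).
Local Notation H := (halving_group (ico2_gen s)).
Local Notation act := (vertex_action ico_gen ico_alphaC s).

Definition odd_coords (c : coords) : bool := \big[addb/false]_(i < 6) (c i).1.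

(** Toggling the reflection bit of one coordinate exchanges even and odd. *)
Lemma card_even_coords :
  (#|[set c : coords | ~~ odd_coords c]%SET| * 2 = (2 * s) ^ 6)%N.
Proof.
pose toggle (c : coords) : coords :=
  [ffun i => if i == ord0 then (~~ (c i).1, (c i).2) else c i].
have toggleK : involutive toggle.
  move=> c; apply/ffunP => i; rewrite !ffunE; case: eqP => // _.
  by rewrite negbK; case: (c i).
have toggle_odd c : odd_coords (toggle c) = ~~ odd_coords c.
  rewrite /odd_coords [in LHS]big_ord_recl [in RHS]big_ord_recl ffunE eqxx /= addNb.
  by congr (~~ (_ (+) _)); apply: eq_bigr => i _; rewrite ffunE.
set A := [set c | _]%SET.
have cardC : #|A| = #|~: A|.
  rewrite -(card_imset _ (inv_inj toggleK)); apply: eq_card => c.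
  rewrite !inE; apply/imsetP/idP => [[c' + ->]|oc].
    by rewrite inE toggle_odd negbK.
  by exists (toggle c); rewrite ?toggleK // inE toggle_odd.
have := cardsC A; rewrite -cardC addnn -muln2 => ->.
by rewrite card_ffun card_prod card_bool !card_ord.
Qed.

Local Notation of_coords := (@of_coordinates _ _ ico_gen ico_alpha s 6 diagonal).
Local Notation to_coords := (@coordinates _ _ ico_gen ico_alpha s 6 diagonal s_gt0).

Let to_coordsK : cancel to_coords of_coords.
Proof.
exact: (coordinatesK ico_alpha_sq ico_alpha_free diagonal_cover diagonal_inj).
Qed.

Let of_coordsK : cancel of_coords to_coords.
Proof. exact: (of_coordinatesK ico_alpha_sq ico_alpha_free diagonal_inj). Qed.

Lemma halving_group_card : ([set: H] #= `I_(60 * (2 * s) ^ 6))%card.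
Proof.
pose even := [set c : 'I_120 * coords | ~~ odd_coords c.2]%SET.
have card_even : #|even| = (60 * (2 * s) ^ 6)%N.
  have -> : even = finset.setX [set: 'I_120]%SET [set c : coords | ~~ odd_coords c]%SET.
    by apply/setP => c; rewrite !inE.
  rewrite cardsX cardsT card_ord -card_even_coords.
  by rewrite [in RHS]mulnC -mulnA (mulnC _ 120).
have elt_of g := cid (ico_elt_surj g).
pose code (x : H) : 'I_120 * coords := (sval (elt_of (val x).1), to_coords (val x).2).
have codeE x : ico_elt (code x).1 = (val x).1 /\ of_coords (code x).2 = (val x).2.
  by split; [rewrite -(svalP (elt_of (val x).1))|rewrite to_coordsK].
have code_inj : injective code.
  move=> x y e; apply: val_inj; have [x1 x2] := codeE x; have [y1 y2] := codeE y.
  by apply: sd_ext; [rewrite -x1 -y1 e|rewrite -x2 -y2 e].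
have parity_coords c : parity (of_coords c) = odd_coords c by exact: parity_coordinates.
have code_even x : code x \in even.
  have := val_even x; rewrite inE /tp_parity -(proj2 (codeE x)) parity_coords.
  by move=> ->.
have code_surj c : c \in even -> exists x, code x = c.
  rewrite inE => ceven.
  pose y := sdinl act (ico_elt c.1) * sdinr act (of_coords c.2).
  have [x xE] : exists x : H, val x = y.
    by apply: even_val => //; rewrite /tp_parity sd_snd parity_coords; exact: negbTE.
  exists x; have [x1 x2] := codeE x.
  have e1 : (code x).1 = c.1 by apply: ico_elt_inj; rewrite x1 xE sd_fst.
  have e2 : (code x).2 = c.2.
    by apply: (can_inj of_coordsK); rewrite x2 xE sd_snd.
  by move: e1 e2; case: (code x) c {ceven y xE} => a b [a' b'] /= -> ->.
pose f (x : H) := val (enum_rank_in (code_even 1) (code x)).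
have f_inj : injective f.
  move=> x y /val_inj/(congr1 enum_val); rewrite !enum_rankK_in //; exact: code_inj.
rewrite -card_even.
suff <- : f @` [set: H] = `I_#|even|.
  by rewrite card_eq_sym; apply: inj_card_eq => x y _ _; exact: f_inj.
apply/seteqP; split=> [_ [x _ <-]|k kn]; first exact: ltn_ord.
have [x xE] := code_surj (enum_val (Ordinal kn)) (enum_valP _).
by exists x => //; rewrite /f xE enum_valK_in.
Qed.

End Order.

(** * The presentation of the halving group *)

Section PresentedQuotient.
Variables (X : choiceType) (R : set (word X)) (S : set (presented R)).

(** Every word representing an element of S is a relator, so no words for the
    elements of S have to be chosen. *)
Definition quotient_relators : set (word X) :=
  [set w | R w \/ S (word_class R w)].

Local Notation Q := (presented quotient_relators).

Definition quotient_proj : presented R -> Q :=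
  presented_lift (presented_gen quotient_relators).

Let projR r : R r -> word_eval (presented_gen quotient_relators) r = 1.
Proof. by move=> Rr; apply: presented_relator; left. Qed.

Lemma quotient_projM : {morph quotient_proj : x y / x * y}.
Proof. exact: presented_liftM projR. Qed.

Lemma quotient_proj_gen x :
  quotient_proj (presented_gen R x) = presented_gen quotient_relators x.
Proof. exact: presented_lift_gen projR x. Qed.

Lemma quotient_proj_class w : quotient_proj (word_class R w) = word_class _ w.
Proof. by rewrite /quotient_proj presented_liftE // word_classE. Qed.

Lemma quotient_proj_relator r : S r -> quotient_proj r = 1.
Proof.
rewrite -(word_class_surj r) quotient_proj_class => Sr.
by rewrite word_classE; apply: presented_relator; right.
Qed.

Lemma normal_closureJ x g : normal_closure S x -> normal_closure S (x ^ g).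
Proof.
move: x; apply: (@generated_min _ ((fun x => x ^ g) @^-1` normal_closure S)).
  apply: preimage_subgroup; last exact: generated_subgroup.
  by move=> x y; exact: conjMg.
move=> _ [r Sr [k _ <-]]; apply: sub_generated; exists r => //; exists (k * g) => //.
by rewrite conjgM.
Qed.

Lemma normal_closure_self r : S r -> normal_closure S r.
Proof.
by move=> Sr; apply: sub_generated; exists r => //; exists 1; rewrite ?conjg1.
Qed.

(** Words that are equivalent in the quotient differ by an element of the normal
    closure. *)
Lemma quotient_proj_ker x : quotient_proj x = 1 -> normal_closure S x.
Proof.
have [N1 NM NV] : is_subgroup (normal_closure S) by exact: generated_subgroup.
have equivN u v : word_equiv quotient_relators u v ->
    normal_closure S (word_class R u * (word_class R v)^-1).
  elim=> {u v} [u|u v _ IH|v u w _ IH1 _ IH2|u u' v v' _ IH1 _ IH2|y b|r [Rr|Sr]].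
  - by rewrite mulgV.
  - by have := NV _ IH; rewrite invgM invgK.
  - by have := NM _ _ IH1 IH2; rewrite mulgA mulgVK.
  - rewrite !word_class_cat invgM.
    have := NM _ _ (normal_closureJ (word_class R u)^-1 IH2) IH1.
    by rewrite conjgE invgK !mulgA mulgVK.
  - rewrite (_ : word_class R _ = 1) ?mulgV //.
    by apply/word_classP; exact: word_equiv_cancel.
  - rewrite (_ : word_class R _ = 1) ?mulgV //.
    by apply/word_classP; exact: word_equiv_rel.
  - by rewrite word_class_nil invg1 mulg1; exact: normal_closure_self.
rewrite -(word_class_surj x) quotient_proj_class -word_class_nil => /word_classP.
by move=> /equivN; rewrite word_class_nil invg1 mulg1.
Qed.

End PresentedQuotient.

Section SignAction.
Variables (K : groupType) (theta : K -> K).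
Hypothesis thetaM : {morph theta : x y / x * y}.
Hypothesis thetaK : involutive theta.

Definition sign_act (x : K) (e : sign) : K := if (e : bool) then theta x else x.

Lemma sign_actM x y e : sign_act (x * y) e = sign_act x e * sign_act y e.
Proof. by case: e => //; exact: thetaM. Qed.

Lemma sign_actA x (e e' : sign) : sign_act x (e * e') = sign_act (sign_act x e) e'.
Proof. by case: e e' => [] [] //=; rewrite /sign_act thetaK. Qed.

Definition sign_action : right_action sign K :=
  RightAction sign_actM (fun=> erefl) sign_actA.

End SignAction.

Lemma string_halving (i j : 'I_3) :
  halving_ico_matrix (lift ord0 i) (lift ord0 j) = string_matrix (p := [:: 3; 5]) i j.
Proof. by case: i j => -[|[|[|//]]] ? [[|[|[|//]]] ?]. Qed.

Section Presentation.
Variable s : nat.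
Hypothesis s_gt1 : (1 < s)%N.

Local Notation C := (coxeter_group halving_ico_matrix).
Local Notation c := (coxeter_gen halving_ico_matrix).
Local Notation beta := (c (inord 1) * c (inord 2) * c (inord 3)).
Local Notation betat := (c (inord 0) * c (inord 2) * c (inord 3)).
Local Notation relators := [set ((betat ^- 3 * beta ^+ 3) ^+ 2);
  ((betat ^+ 5 * beta ^+ 5) ^+ s)].

Local Notation V := (vertex ico_gen).
Local Notation W := (vertex_group ico_gen ico_alpha s).
Local Notation TP := (two_power_group ico_gen ico_alphaC s).
Local Notation sg := (@sigma _ _ ico_gen ico_alpha s).

(** The group given by the presentation that is to be verified. *)
Definition presented_halving : groupType := presented (@quotient_relators _ _ relators).

Definition ph_gen (i : nat) : presented_halving := presented_gen _ (inord i).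

Local Notation proj :=
  (@quotient_proj _ (coxeter_relators halving_ico_matrix) relators).

Lemma projM : {morph (proj : C -> presented_halving) : x y / x * y}.
Proof. exact: quotient_projM. Qed.

Lemma proj_c i : proj (c (inord i)) = ph_gen i.
Proof. exact: quotient_proj_gen. Qed.

Lemma ph_genE i j : (ph_gen i * ph_gen j) ^+ halving_ico_matrix (inord i) (inord j) = 1.
Proof.
rewrite -!proj_c -projM -(morph_exp projM) coxeter_genE; exact: (morph_one projM).
Qed.

Definition ph_beta : presented_halving := ph_gen 1 * ph_gen 2 * ph_gen 3.
Definition ph_betat : presented_halving := ph_gen 0 * ph_gen 2 * ph_gen 3.

Lemma ph_relators : (ph_betat ^- 3 * ph_beta ^+ 3) ^+ 2 = 1 /\
  (ph_betat ^+ 5 * ph_beta ^+ 5) ^+ s = 1.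
Proof.
have projb : proj beta = ph_beta by rewrite !projM !proj_c.
have projbt : proj betat = ph_betat by rewrite !projM !proj_c.
split; rewrite -projb -projbt -?(morph_exp projM) -?(morph_inv projM) -projM
  -(morph_exp projM); apply: quotient_proj_relator; [by left|by right].
Qed.

Definition swap01 (i : nat) : nat := if i is 0 then 1 else if i is 1 then 0 else i.

Definition swap_letter (i : 'I_4) : 'I_4 := inord (swap01 i).

Lemma swap_letter_matrix i j :
  halving_ico_matrix (swap_letter i) (swap_letter j) = halving_ico_matrix i j.
Proof.
rewrite /halving_ico_matrix /swap_letter -!val_eqE.
by case: i j => -[|[|[|[|//]]]] ? [[|[|[|[|//]]]] ?]; rewrite /= !inordK.
Qed.

Local Notation pgen := (presented_gen
  (@quotient_relators _ (coxeter_relators halving_ico_matrix) relators)).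

Let swap_gen i : presented_halving := pgen (swap_letter i).

Let swap_genE i j : (swap_gen i * swap_gen j) ^+ halving_ico_matrix i j = 1.
Proof.
rewrite -swap_letter_matrix.
rewrite /swap_gen -[swap_letter i]inord_val -[swap_letter j]inord_val; exact: ph_genE.
Qed.

(** The diagram symmetry exchanging the generators 0 and 1: it sends betat^-3
    beta^3 to its inverse and betat^5 beta^5 to a conjugate, so it respects the
    relators. *)
Definition ph_swap : presented_halving -> presented_halving := presented_lift swap_gen.

Let swap_gen_ord i : (i < 4)%N -> swap_gen (inord i) =
  ph_gen (swap01 i).
Proof. by move=> i4; rewrite /swap_gen /swap_letter inordK. Qed.

Let swap_genR r : quotient_relators relators r -> word_eval swap_gen r = 1.
Proof.
case=> [[i [j ->]]|Sr]; first by rewrite word_eval_coxeter_relator swap_genE.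
have M := coxeter_liftM swap_genE.
have g i := coxeter_lift_gen swap_genE i.
have -> : word_eval swap_gen r =
    coxeter_lift swap_gen (word_class (coxeter_relators halving_ico_matrix) r).
  rewrite /coxeter_lift presented_liftE // => _ [i [j ->]].
  by rewrite word_eval_coxeter_relator swap_genE.
have Mb : coxeter_lift swap_gen beta = ph_betat by rewrite !M !g !swap_gen_ord.
have Mbt : coxeter_lift swap_gen betat = ph_beta by rewrite !M !g !swap_gen_ord.
have [r1 r2] := ph_relators.
case: Sr => ->; rewrite (morph_exp M) M ?(morph_inv M) !(morph_exp M) Mb Mbt.
  have -> : ph_beta ^- 3 * ph_betat ^+ 3 = (ph_betat ^- 3 * ph_beta ^+ 3)^-1.
    by rewrite [RHS]invgM invgK.
  by rewrite expVgn r1 invg1.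
exact: mul_swap_exp.
Qed.

Lemma ph_swapM : {morph ph_swap : x y / x * y}.
Proof. exact: presented_liftM swap_genR. Qed.

Lemma ph_swap_gen i : (i < 4)%N ->
  ph_swap (ph_gen i) = ph_gen (swap01 i).
Proof. by move=> i4; rewrite -swap_gen_ord //; exact: presented_lift_gen. Qed.

Lemma ph_swapK : involutive ph_swap.
Proof.
apply: presented_hom_ext => // [x y|i]; first by rewrite !ph_swapM.
rewrite -[i]inord_val -/(ph_gen i).
by case: i => -[|[|[|[|//]]]] ilt; rewrite /= !ph_swap_gen.
Qed.

Local Notation act := (vertex_action ico_gen ico_alphaC s).
Local Notation EG := (semidirect (sign_action ph_swapM ph_swapK)).
Local Notation inK := (sdinr (sign_action ph_swapM ph_swapK)).

(** Adjoining an involution that induces the diagram symmetry restores the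
    reflection at the base vertex, which conjugates generator 1 into generator
    0. *)
Definition reflection0 : EG := sdinl _ (true : sign).

Local Notation r0 := reflection0.

Lemma r0_sq : r0 * r0 = 1. Proof. by rewrite -sdinlM. Qed.

Lemma inKM : {morph inK : x y / x * y}. Proof. exact: sdinrM. Qed.

Lemma inK_inj : injective inK. Proof. by move=> x y /(congr1 snd). Qed.

Lemma ph_swap_beta : ph_swap ph_beta = ph_betat.
Proof. by rewrite !ph_swapM !ph_swap_gen. Qed.

Lemma inK_r0 x : inK x * r0 = r0 * inK (ph_swap x).
Proof. exact: sdinr_inl. Qed.

Let eg_gen (i : 'I_3) : EG := inK (ph_gen i.+1).

Lemma inord_lift0 (i : 'I_3) : inord i.+1 = lift ord0 i :> 'I_4.
Proof. by apply: val_inj; rewrite /= inordK // ltnS. Qed.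

Let eg_genE i j : (eg_gen i * eg_gen j) ^+ string_matrix (p := [:: 3; 5]) i j = 1.
Proof.
rewrite -inKM -(morph_exp inKM) -string_halving -!inord_lift0 ph_genE.
exact: (morph_one inKM).
Qed.

Definition ico_image : ico_group -> EG := coxeter_lift eg_gen.

Local Notation qG := ico_image.

Lemma qGM : {morph qG : g g' / g * g'}.
Proof. exact: coxeter_liftM eg_genE. Qed.

Lemma qG_letter i : (i < 3)%N -> qG (ico_letter i) = inK (ph_gen i.+1).
Proof.
move=> i3; rewrite /ico_letter /qG; have := coxeter_lift_gen eg_genE (inord i).
by rewrite /eg_gen inordK.
Qed.

Lemma qG_beta : qG (ico_letter 0 * ico_letter 1 * ico_letter 2) = inK ph_beta.
Proof. by rewrite !qGM !qG_letter // -!inKM. Qed.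

Lemma qG_alpha : qG ico_alpha = inK (ph_beta ^+ 5).
Proof.
by rewrite /ico_alpha (morph_exp qGM) qG_beta (morph_exp inKM).
Qed.

Lemma qG_stab d : vertex_stabilizer ico_gen d -> commute r0 (qG d).
Proof.
pose A := [set y : EG | commute r0 y].
have Agrp : is_subgroup A.
  split=> [|x y|x]; [exact: commute1|exact: commuteM|exact: commuteV].
move: d; apply: (@generated_min _ (qG @^-1` A)).
  exact: (preimage_subgroup qGM Agrp).
move=> _ [i i0 <-]; rewrite /preimage /mkset ico_letter_ord qG_letter // /A /mkset.
have e : ph_swap (ph_gen i.+1) = ph_gen i.+1.
  by rewrite ph_swap_gen //; case: i i0 => -[].
by rewrite /commute inK_r0 e.
Qed.

Lemma r0_conj x : r0 * r0 ^ inK x = inK (ph_swap x^-1 * x).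
Proof.
by rewrite conjgE -(morph_inv inKM) !mulgA -[r0 * _ * r0]mulgA inK_r0 !mulgA r0_sq
  mul1g -inKM.
Qed.

(** This does not depend on the element chosen to move the base vertex to F,
    because r0 commutes with the images of the stabilizer of the base vertex. *)
Definition vertex_image (F : V) : EG := r0 ^ qG (sval (cid (vertexP F))).

Lemma vertex_imageE g : vertex_image (vact F0 g) = r0 ^ qG g.
Proof.
rewrite /vertex_image; case: cid => h /= /esym hg.
have /qG_stab cgh : vertex_stabilizer ico_gen (h * g^-1).
  rewrite ico_parabolic0; apply/fix_base_stab => //.
  by rewrite vactM hg -vactM mulgV vact1.
by rewrite -[h in LHS](mulgVK g) qGM conjgM /conjg cgh mulKg.
Qed.

(** It suffices to treat one vertex from each orbit of the base vertex
    stabilizer. The antipode and the neighbours' antipodes need the two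
    additional relators, the neighbours need only that the generators 0 and 1
    commute. *)
Lemma vertex_image_relation h :
  (r0 * r0 ^ qG h) ^+ vertex_matrix ico_alpha s F0 (vact F0 h) = 1.
Proof.
rewrite -(vertex_imageE h) /vertex_matrix; case: eqP => [->|n0].
  by rewrite -(vact1 F0) vertex_imageE (morph_one qGM) conjg1 r0_sq.
case: eqP => [->|nA].
  rewrite vertex_imageE qG_alpha r0_conj -(morph_exp inKM).
  have bb : (ph_beta ^+ 5)^-1 = ph_beta ^+ 5.
    apply: mulg1_eq; apply: inK_inj; rewrite inKM -qG_alpha -qGM ico_alpha_sq.
    by rewrite (morph_one qGM) (morph_one inKM).
  by rewrite bb (morph_exp ph_swapM) ph_swap_beta (proj2 ph_relators) (morph_one inKM).
have [d [/qG_stab cd dE]] := ico_stab_orbits h.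
have conj_d g : (r0 * r0 ^ qG g) ^+ 2 = 1 -> (r0 * r0 ^ qG (g * d)) ^+ 2 = 1.
  move=> e; have r0d : r0 ^ qG d = r0 by rewrite /conjg cd mulKg.
  by rewrite qGM conjgM -[X in X * _]r0d -conjMg -conjXg e conj1g.
case: dE => [//|//|->|->]; rewrite vertex_imageE; apply: conj_d.
  rewrite qG_letter // r0_conj -(morph_exp inKM).
  have -> : (ph_gen 1)^-1 = ph_gen 1.
    by apply: mulg1_eq; have := ph_genE 1 1; rewrite /halving_ico_matrix inordK // eqxx.
  rewrite ph_swap_gen //; have := ph_genE 0 1.
  by rewrite /halving_ico_matrix -val_eqE /= !inordK // => ->; rewrite (morph_one inKM).
rewrite (morph_exp qGM) qG_beta -(morph_exp inKM) r0_conj -(morph_exp inKM).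
rewrite (morph_inv ph_swapM) (morph_exp ph_swapM) ph_swap_beta (proj1 ph_relators).
exact: (morph_one inKM).
Qed.

Let vertex_image_genE F F' :
  (vertex_image F * vertex_image F') ^+ vertex_matrix ico_alpha s F F' = 1.
Proof.
have [g ->] := vertexP F; have [g' ->] := vertexP F'.
have -> : vact F0 g' = vact (vact F0 (g' * g^-1)) g by rewrite -vactM mulgVK.
rewrite (vertex_matrixJ ico_alphaC) -vactM !vertex_imageE qGM conjgM -conjMg -conjXg.
by rewrite vertex_image_relation conj1g.
Qed.

Definition vertex_group_image : W -> EG := coxeter_lift vertex_image.

Local Notation qW := vertex_group_image.

Lemma qWM : {morph qW : v w / v * w}.
Proof. exact: coxeter_liftM vertex_image_genE. Qed.

Lemma qW_sigma F : qW (sg F) = vertex_image F.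
Proof. exact: coxeter_lift_gen vertex_image_genE F. Qed.

Lemma qWJ w g : qW (act w g) = qW w ^ qG g.
Proof.
elim/vertex_groupM_ind: w => [|w F IH].
  by rewrite ract_one (morph_one qWM) conj1g.
rewrite ractM !qWM IH conjMg actE !qW_sigma; have [h ->] := vertexP F.
by rewrite -vactM !vertex_imageE qGM conjgM.
Qed.

Definition two_power_image (x : TP) : EG := qG x.1 * qW x.2.

Lemma two_power_imageM : {morph two_power_image : x y / x * y}.
Proof.
move=> x y; rewrite /two_power_image sd_mul1 sd_mul2 qGM qWM qWJ conjgE.
by rewrite !mulgA mulgK.
Qed.

Local Notation rho := (ico2_gen s).
Local Notation H := (halving_group rho).
Local Notation h := (halving_gen rho).
Local Notation fam := (halving_family rho).
Local Notation inl := (sdinl act).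
Local Notation inr := (sdinr act).
Local Notation S := (inr (sg F0)).

Lemma base_vact_neq g : (1 < ico_pt g 0)%N ->
  vact F0 g <> F0 /\ vact F0 g <> vact F0 ico_alpha.
Proof.
move=> g1; split; last by rewrite base_vactE ico_pt_antipode // => e; rewrite e in g1.
by rewrite -(vact1 F0) -vactM mul1g base_vactE ico_pt1 // => e; rewrite e in g1.
Qed.

Lemma conjS_mul g g' : (S * inl g * S) * inl g' =
  inl (g * g') * inr (sg (vact F0 (g * g')) * sg (vact F0 g')).
Proof. by rewrite conjS -mulgA sdinr_inl ractM !actE -vactM mulgA -sdinlM. Qed.

Lemma conjS_letter i :
  (0 < i < 3)%N -> S * inl (ico_letter i) * S = inl (ico_letter i).
Proof.
move=> /andP[i0 i3]; have e : vact F0 (ico_letter i) = F0.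
  apply/fix_base_stab; have := @letter_parabolic (inord i) 0 isT.
  by rewrite /= inordK //; apply; rewrite -lt0n.
by rewrite conjS e sigma_sq (morph_one (@sdinrM _ _ act)) mulg1.
Qed.

Lemma fam_relation i j : (fam i * fam j) ^+ halving_ico_matrix i j = 1.
Proof.
have inl1 := morph_one (@sdinlM _ _ act).
have conj1 : S * 1 * S = 1 by rewrite mulg1 S_sq.
have lift_lift (k l : 'I_3) :
    (ico_letter k * ico_letter l) ^+ halving_ico_matrix (lift ord0 k) (lift ord0 l) = 1.
  by rewrite string_halving -!ico_letter_ord; exact: coxeter_genE.
have zero_lift (l : 'I_3) :
    (fam ord0 * fam (lift ord0 l)) ^+ halving_ico_matrix ord0 (lift ord0 l) = 1.
  rewrite fam0 famS; have [->|l0] := eqVneq l ord0.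
    have /base_vact_neq[n0 nA] : (1 < ico_pt (ico_letter 0) 0)%N.
      by rewrite ico_pt_letter.
    rewrite conjS_mul ico_letter_sq vact1 inl1 mul1g -(morph_exp (@sdinrM _ _ act)).
    by rewrite (@sigma_prod_sq _ _ _ _ _ F0) // (morph_one (@sdinrM _ _ act)).
  have -> : S * inl (ico_letter 0) * S * inl (ico_letter l) =
      S * inl (ico_letter 0 * ico_letter l) * S.
    by rewrite sdinlM conjSM (@conjS_letter l) // lt0n l0 ltn_ord.
  rewrite -(morph_exp (@conjSM s)) -(morph_exp (@sdinlM _ _ act)).
  have -> : halving_ico_matrix ord0 (lift ord0 l) =
      halving_ico_matrix (lift ord0 ord0) (lift ord0 l).
    by case: l l0 => -[|[|[|//]]] // ? _.
  by rewrite (lift_lift ord0) inl1 conj1.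
elim/ord_cases: i => [|k]; elim/ord_cases: j => [|l] //.
- by rewrite fam0 -conjSM -sdinlM ico_letter_sq inl1 conj1.
- rewrite (_ : halving_ico_matrix _ _ = halving_ico_matrix ord0 (lift ord0 k)).
    exact: mul_swap_exp (zero_lift k).
  by case: k => -[|[|[|//]]].
- by rewrite !famS -sdinlM -(morph_exp (@sdinlM _ _ act)) lift_lift inl1.
Qed.

Let halving_gen_relation i j : (h i * h j) ^+ halving_ico_matrix i j = 1.
Proof.
apply: val_inj; have valM : {morph (val : H -> TP) : x y / x * y} by [].
by rewrite (morph_exp valM) valM /= fam_relation.
Qed.

Definition halving_presentation : C -> H := coxeter_lift h.

Local Notation p := halving_presentation.

Lemma halving_presentationM : {morph p : x y / x * y}.
Proof. exact: coxeter_liftM halving_gen_relation. Qed.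

HB.instance Definition _ :=
  isMultiplicative.Build C H halving_presentation halving_presentationM.

Lemma halving_presentation_gen i : p (c i) = h i.
Proof. exact: coxeter_lift_gen halving_gen_relation i. Qed.

Lemma halving_presentation_surj y : exists x, p x = y.
Proof.
have := @halving_cap s s_gt1 set0 y (fun j => False_ind _); move: y.
apply: generated_min; last first.
  by move=> _ [i _ <-]; exists (c i); exact: halving_presentation_gen.
have M := halving_presentationM.
split=> [|_ _ [x <-] [x' <-]|_ [x <-]].
- by exists 1; exact: (morph_one M).
- by exists (x * x'); exact: M.
- by exists x^-1; exact: (morph_inv M).
Qed.

Definition tp_val (x : C) : TP := val (p x).

Lemma tp_valM : {morph tp_val : x y / x * y}.
Proof. by move=> x y; rewrite /tp_val halving_presentationM. Qed.

Lemma tp_val_gen i : tp_val (c i) = fam i.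
Proof. by rewrite /tp_val halving_presentation_gen. Qed.

(** The map from 2^(P,G(s)) back to the presented group, so that an element of
    the Coxeter group that dies in the halving group dies in the presented
    group. *)
Lemma tp_val_image x : two_power_image (tp_val x) = inK (proj x).
Proof.
have MI x' y' : two_power_image (tp_val (x' * y')) =
    two_power_image (tp_val x') * two_power_image (tp_val y').
  by rewrite tp_valM two_power_imageM.
move: x; apply: (@presented_hom_ext _ _ _ (two_power_image \o tp_val) (inK \o proj)).
- exact: MI.
- by move=> x y /=; rewrite projM inKM.
move=> i; rewrite /comp -[presented_gen _ i]/(c i) tp_val_gen.
have inlI g : two_power_image (inl g) = qG g.
  by rewrite /two_power_image (morph_one qWM) mulg1.
have SI : two_power_image S = r0.
  rewrite /two_power_image (morph_one qGM) mul1g qW_sigma -(vact1 F0) vertex_imageE.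
  by rewrite (morph_one qGM) conjg1.
elim/ord_cases: i => [|i].
  rewrite fam0 !two_power_imageM SI inlI qG_letter // -mulgA inK_r0 mulgA r0_sq mul1g.
  rewrite ph_swap_gen //; congr inK; rewrite -proj_c; congr (proj (c _)).
  by apply: val_inj; rewrite /= inordK.
rewrite famS inlI qG_letter // -proj_c inord_lift0 //.
Qed.

Lemma fam_inord i : (i < 3)%N -> fam (inord i.+1) = inl (ico_letter i).
Proof.
by move=> i3; have := famS s (inord i); rewrite -inord_lift0 /= inordK.
Qed.

Local Notation ico_beta := (ico_letter 0 * ico_letter 1 * ico_letter 2).

Lemma tp_val_beta : tp_val beta = inl ico_beta.
Proof. by rewrite !tp_valM !tp_val_gen !fam_inord // -!sdinlM. Qed.

Lemma tp_val_betat : tp_val betat = S * inl ico_beta * S.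
Proof.
have -> : inord 0 = ord0 :> 'I_4 by apply: val_inj; rewrite /= inordK.
rewrite !tp_valM !tp_val_gen !fam_inord // fam0.
by rewrite -(@conjS_letter 1) // -(@conjS_letter 2) // -!conjSM -!sdinlM.
Qed.

(** Both relators are powers of such products: for g the third and the fifth
    power of the Coxeter element. *)
Lemma conjS_inl g : S * inl g^-1 * S * inl g = inr (sg F0 * sg (vact F0 g)).
Proof.
rewrite conjS_mul mulVg vact1 (morph_one (@sdinlM _ _ act)) mul1g //.
Qed.

Lemma tp_val_relator r : relators r -> tp_val r = 1.
Proof.
have M := tp_valM; have r1 := morph_one (@sdinrM _ _ act).
have conjX g k : (S * inl g * S) ^+ k = S * inl (g ^+ k) * S.
  by rewrite -(morph_exp (@conjSM s)) -(morph_exp (@sdinlM _ _ act)).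
have inlX g k : (inl g) ^+ k = inl (g ^+ k) by rewrite -(morph_exp (@sdinlM _ _ act)).
case=> ->; rewrite (morph_exp M) M ?(morph_inv M) !(morph_exp M).
all: rewrite tp_val_beta tp_val_betat.
  rewrite conjX inlX -(morph_inv (@conjSM s)) -(morph_inv (@sdinlM _ _ act)) conjS_inl.
  have /base_vact_neq[n0 nA] : (1 < ico_pt (ico_beta ^+ 3) 0)%N by rewrite ico_pt_beta3.
  by rewrite -(morph_exp (@sdinrM _ _ act)) sigma_prod_sq.
rewrite conjX inlX -/ico_alpha.
have aV : ico_alpha^-1 = ico_alpha by apply: mulg1_eq; exact: ico_alpha_sq.
have := conjS_inl ico_alpha; rewrite aV => ->; rewrite -(morph_exp (@sdinrM _ _ act)).
by rewrite (sigma_antipode s ico_alpha_free).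
Qed.

Lemma halving_presentation_ker x : p x = 1 <-> normal_closure relators x.
Proof.
have M := halving_presentationM; split=> [px1|].
  apply: quotient_proj_ker; apply: inK_inj.
  rewrite -tp_val_image /tp_val px1 (morph_one inKM).
  exact: (morph_one two_power_imageM).
have one_grp : is_subgroup [set y : H | y = 1].
  by split=> [//|y z -> ->|y ->]; rewrite /mkset ?mulg1 ?invg1.
move: x; apply: (@generated_min _ (p @^-1` [set 1])).
  exact: (preimage_subgroup M one_grp).
move=> _ [r /tp_val_relator Sr [g _ <-]]; rewrite /preimage /mkset.
have pr : p r = 1 by apply: val_inj.
by rewrite /conjg !M pr mul1g -M mulVg (morph_one M).
Qed.

End Presentation.

Theorem proposition4p2 (s : nat) (hs : (2 <= s)%N) :
  let rho : 'I_4 -> two_power_group ico_gen ico_alphaC s := ico2_gen s in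
  let H : groupType := halving_group rho in
  let h : 'I_4 -> H := halving_gen rho in
  let Gam : incidence_system 'I_4 := halving_system rho in
  let C : groupType := coxeter_group halving_ico_matrix in
  let c : 'I_4 -> C := coxeter_gen halving_ico_matrix in
  let beta : C := (c (inord 1) * c (inord 2) * c (inord 3))%g in
  let betat : C := (c (inord 0) * c (inord 2) * c (inord 3))%g in
  let relators : set C :=
    [set ((betat ^- 3 * beta ^+ 3) ^+ 2)%g;
         ((betat ^+ 5 * beta ^+ 5) ^+ s)%g]%classic in
  [/\ regular_hypertope Gam,
      (* H, acting by right translation, is the automorphism group of Gam *)
      exists phi : {multiplicative H -> taut Gam},
        bijective phi /\
        forall (g : H) (x : Gam),
          itype (phi g x) = itype x /\
          celt_set (phi g x) = rcoset (celt_set x) g,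
      ([set: H] #= `I_(60 * (2 * s) ^ 6))%card
    & (* H is the quotient of C by the normal closure of the relators *)
      exists p : {multiplicative C -> H},
        [/\ forall i, p (c i) = h i,
            forall y : H, exists x : C, p x = y
          & forall x : C, p x = 1%g <-> normal_closure relators x]].
Proof.
move=> rho H h Gam C c beta betat relators; split.
- exact: halving_regular_hypertope hs.
- exact: halving_automorphism_group hs.
- exact: halving_group_card hs.
exists (halving_presentation s); split.
- exact: halving_presentation_gen.
- exact: halving_presentation_surj hs.
- exact: halving_presentation_ker.
Qed.
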